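(* Let $h\ge 2$ and let $D_h$ be the weighted directed graph, with designated start vertex $s$ and designated set $A$ of accepting vertices, whose construction is described in the context. Walks in $D_h$ that start at the start vertex, end at an accepting vertex, and have weight $x^ny^k$ (the set of these is denoted $\mathcal W_{n,k}$) are in bijection with growing self-avoiding walks on $\mathcal G_h$, starting at the top-left corner $(0,h-1)$, with $n$ edges and displacement $k$ (the set of these is denoted $\mathcal S_{n,k}$). As a consequence, the generating function $\sum_{n,k}|\mathcal S_{n,k}|x^ny^k$ for GSAWs on $\mathcal G_h$ can be found by applying the transfer matrix method to $D_h$, i.e. as the sum over $t\in A$ of the $(s,t)$ entries of $(I-M)^{-1}$, where $M$ is the matrix indexed by the vertices of $D_h$ whose $(i,j)$ entry is the sum of the weights of all edges from $i$ to $j$.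
   Context: **GSAWs.** $\mathcal G_h$ is the graph with vertex set $\mathbb N\times\{0,\dots,h-1\}$ ($0\in\mathbb N$), with an edge between any two points at distance $1$. A growing self-avoiding walk (GSAW) is a directed walk that does not visit the same vertex twice and whose endpoint is trapped, i.e. has no unoccupied neighbor. Its length is its number of edges; its displacement is the difference between the largest and smallest $x$-coordinates of its vertices (on $\mathcal G_h$, starting from $(0,h-1)$, this is the largest $x$-coordinate). The weight of a walk in a weighted directed graph is the product of the weights of the edges it traverses. **Frames.** A path is a nonempty sequence of points forming a sequence of directed edges with consistent directionality (each internal vertex is the end of one edge and the start of another); it may be a single point. A segment is an ordered list of paths sharing no vertices. A frame is an ordered list of segments sharing no vertices. The start of a segment is the first point of its first path, and its end is the last point of its last path. Frames here have width $2$ (a left and a right column) and height $h$. A frame is meant to record the edges of a GSAW lying in two consecutive columns: the order of segments and of paths within a segment is the order of traversal, and paths are in the same segment when they are already connected by edges in the columns up to and including the frame. **Vertices of $D_h$.** All possible frames, together with one additional vertex $s$, the start vertex. **Edges from $s$.** There is an edge of weight $x^dy$ from $s$ to each frame that is a valid first frame with $d$ edges. The valid first frames are those in which all segments consist of a single path, only the last segment may consist of a single point, the first segment starts in the top-left corner $(0,h-1)$, the starts of all other segments are in the right column, the ends of all segments (except possibly the last) are in the right column, if the end of the last segment is in the left column then it is trapped, and if the last segment is a single point in the right column then it is also trapped. **Edges between frames.** Given a frame $F$, add an empty column on the right and extend the segments of $F$ in all possible ways into the wider frame, as follows; the resulting (possibly empty) set of width-$3$ extended frames is $E(F)$. 1.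 In any frame that is part of a GSAW, the start and end of every segment must be in the right column, except for the start of the first segment (which will never be in the right column) and the end of the last segment (which may be in the right column but is not required to be). A frame not satisfying this condition has no outgoing edges. 2. In any extension of $F$, the start and end of every segment, except the start of the first and the end of the last, must be extended rightward into the new rightmost column. The end of the last segment may be extended into the new rightmost column if possible, but this is not required (unless a new segment is later added in the last position in step 4). 3. Each of these extended ends may then move upward or downward any number of edges in the new rightmost column, as long as they do not overlap. Additionally, the end of each segment $i$ may join up to the start of the next segment $i+1$ if this causes no overlap with the vertices of any other segments; the two segments are then merged into one. Segments may merge only with the next segment in order, but multiple merges may occur. 4. New segments may be inserted at any position in the ordered list of segments except the first (the first segment must always be the one that started in the top-left corner of $\mathcal G_h$). A new segment is a single path moving upward or downward any number of vertices in the rightmost column, not overlapping vertices of other segments. If a new segment is the last segment of the frame, it may be a single point; in this case, when it is extended later, this point is considered the end, and the start is extended rightward. New segments that are not last must have at least two vertices. If a new segment is made the last segment, then the previous last segment must have had its endpoint extended rightward. From $E(F)$ remove every extended frame in which the end of the last segment is not trapped and either the end of the last segment is not in the rightmost column or the last segment is a single point in the rightmost column (either of which indicates that the end of this segment is bound to be the last point of the GSAW). Each remaining extended frame is trimmed to width $2$: its leftmost column and all edges incident to any vertex of that column are removed; this may split paths into multiple paths, whose relative order within the segment is maintained, while a segment never splits into multiple segments. The set of trimmed frames is $N(F)$, and for each $F'\in N(F)$ there is a directed edge $F\to F'$ of weight $x^ny$, where $n$ is the number of new edges added in the extension. **Accepting vertices.** The frames that contain a single segment (with one or multiple paths) whose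 end is in the leftmost column.
   Formalization: Formally, every column of a frame or extended frame must contain a vertex (so no empty extensions), and the removal test is skipped when the end of the last segment is in the leftmost column of the extended frame; taken literally, the bijection fails (h=2, weight x^3y^2; h=3). *)

(* Defs.v *)
From HB Require Import structures.
From mathcomp Require Import all_boot all_order all_algebra finmap.
From mathcomp Require Import boolp classical_sets functions cardinality.

Set Implicit Arguments.
Unset Strict Implicit.
Unset Printing Implicit Defensive.

Import GRing.Theory.

(* [FPS f] is the series \sum_n f n * X ^ n. *)
Record fps (R : Type) := FPS { fcoef : nat -> R }.

Section FpsRing.
Local Open Scope ring_scope.

Lemma fpsP (R : Type) (f g : fps R) : fcoef f =1 fcoef g -> f = g.
Proof. by case: f g => [f] [g] /= /funext ->. Qed.

HB.instance Definition _ (R : Type) := gen_eqMixin (fps R).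
HB.instance Definition _ (R : Type) := gen_choiceMixin (fps R).

Section Zmod.
Variable R : zmodType.
Implicit Types f g : fps R.

Definition fps_zero : fps R := FPS (fun=> 0).
Definition fps_opp f : fps R := FPS (fun n => - fcoef f n).
Definition fps_add f g : fps R := FPS (fun n => fcoef f n + fcoef g n).

Lemma fps_addA : associative fps_add.
Proof. by move=> f g k; apply: fpsP => n /=; rewrite addrA. Qed.
Lemma fps_addC : commutative fps_add.
Proof. by move=> f g; apply: fpsP => n /=; rewrite addrC. Qed.
Lemma fps_add0 : left_id fps_zero fps_add.
Proof. by move=> f; apply: fpsP => n /=; rewrite add0r. Qed.
Lemma fps_addN : left_inverse fps_zero fps_opp fps_add.
Proof. by move=> f; apply: fpsP => n /=; rewrite addNr. Qed.

HB.instance Definition _ :=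
  GRing.isZmodule.Build (fps R) fps_addA fps_addC fps_add0 fps_addN.
End Zmod.

Section ComNzRing.
Variable R : comNzRingType.
Implicit Types f g : fps R.

Definition fps_one : fps R := FPS (fun n => (n == 0%N)%:R).
Definition fps_mul f g : fps R :=
  FPS (fun n => \sum_(i < n.+1) fcoef f i * fcoef g (n - i)).

Definition fps_trunc N f : {poly R} := \poly_(i < N) fcoef f i.

Lemma coef_fps_trunc N f n : (n < N)%N -> (fps_trunc N f)`_n = fcoef f n.
Proof. by move=> ltnN; rewrite coef_poly ltnN. Qed.

Lemma fcoef_mul N f g n : (n < N)%N ->
  fcoef (fps_mul f g) n = (fps_trunc N f * fps_trunc N g)`_n.
Proof.
move=> ltnN; rewrite coefM; apply: eq_bigr => i _.
rewrite !coef_fps_trunc ?(leq_ltn_trans (leq_subr _ _)) //.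
by rewrite (leq_ltn_trans _ ltnN) // -ltnS.
Qed.

Lemma fps_mulC : commutative fps_mul.
Proof.
by move=> f g; apply: fpsP => n; rewrite !(@fcoef_mul n.+1) // mulrC.
Qed.

Lemma fps_mulA : associative fps_mul.
Proof.
move=> f g k; apply: fpsP => n.
have trM (a b : fps R) m : (m < n.+1)%N ->
    (fps_trunc n.+1 (fps_mul a b))`_m
    = (fps_trunc n.+1 a * fps_trunc n.+1 b)`_m.
  by move=> ltm; rewrite coef_fps_trunc // (@fcoef_mul n.+1).
rewrite !(@fcoef_mul n.+1) //.
transitivity ((fps_trunc n.+1 f * (fps_trunc n.+1 g * fps_trunc n.+1 k))`_n).
  by rewrite !coefM; apply: eq_bigr => i _; rewrite trM // ltnS leq_subr.
rewrite mulrA !coefM; apply: eq_bigr => i _; rewrite trM //.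
Qed.

Lemma fps_mul1 : left_id fps_one fps_mul.
Proof.
move=> f; apply: fpsP => n /=.
rewrite big_ord_recl /= mul1r subn0 big1 ?addr0 // => i _.
by rewrite /= mul0r.
Qed.

Lemma fps_mulDl : left_distributive fps_mul (@fps_add R).
Proof.
move=> f g k; apply: fpsP => n /=; rewrite -big_split /=.
by apply: eq_bigr => i _; rewrite mulrDl.
Qed.

Lemma fps_one_neq0 : fps_one != 0 :> fps R.
Proof.
by apply/eqP => /(congr1 (fun f => fcoef f 0)) /= /eqP; rewrite oner_eq0.
Qed.

HB.instance Definition _ := GRing.Zmodule_isComNzRing.Build (fps R)
  fps_mulA fps_mulC fps_mul1 fps_mulDl fps_one_neq0.

Definition fps_unit : {pred fps R} :=
  fun f => `[< exists g : fps R, g * f = 1 >].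
Definition fps_inv f : fps R := xget f [set g : fps R | g * f = 1].

Lemma fps_mulV : {in fps_unit, left_inverse 1 fps_inv *%R}.
Proof.
move=> f /asboolP[g gf1].
exact: (@xgetPex _ f [set g : fps R | g * f = 1] (ex_intro _ g gf1)).
Qed.

Lemma fps_unitPl f g : g * f = 1 -> fps_unit f.
Proof. by move=> gf1; apply/asboolP; exists g. Qed.

Lemma fps_inv_out : {in [predC fps_unit], fps_inv =1 id}.
Proof.
move=> f /negP nf; rewrite /fps_inv; case: xgetP => // g _ gf1.
by case: nf; apply: (fps_unitPl gf1).
Qed.

HB.instance Definition _ := GRing.ComNzRing_hasMulInverse.Build (fps R)
  fps_mulV fps_unitPl fps_inv_out.
End ComNzRing.

End FpsRing.

(* Power series in x and y with integer coefficients: the outer variable is x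
   and the inner one is y. *)
Notation fps_xy := (fps (fps int)).
Definition fps_x : fps_xy := FPS (fun n => (n == 1)%:R%R).
Definition fps_y : fps_xy :=
  FPS (fun n => if n == 0 then FPS (fun k => (k == 1)%:R%R) else 0%R).

Record wdigraph (R : Type) := WDigraph {
  vertex : finType;
  edge : finType;
  src : edge -> vertex;
  tgt : edge -> vertex;
  wt : edge -> R
}.

Section WeightedDigraph.
Variables (R : comNzRingType) (G : wdigraph R).

Fixpoint is_walk (u : vertex G) (p : seq (edge G)) (v : vertex G) : bool :=
  if p is e :: p' then (src e == u) && is_walk (tgt e) p' v else u == v.

Definition walk_weight (p : seq (edge G)) : R := (\prod_(e <- p) wt e)%R.

Definition transfer_mx : 'M[R]_#|vertex G| :=
  (\matrix_(i, j)
     \sum_(e : edge G | (src e == enum_val i) && (tgt e == enum_val j)) wt e)%R.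

End WeightedDigraph.

(* A point (c, r) lies in column c and row r; the top row is h.-1. *)
Notation point := (nat * nat)%type.
Notation pt0 := (0, 0).

Definition distn1 (a b : nat) := (a - b) + (b - a).
Definition adj : rel point :=
  fun p q => distn1 p.1 q.1 + distn1 p.2 q.2 == 1.

Definition in_strip (h : nat) : pred point := fun p => p.2 < h.

Definition trapped (V : pred point) (occupied : seq point) (p : point) : Prop :=
  forall q, V q -> adj p q -> q \in occupied.

Definition gsaw (h : nat) (w : seq point) : Prop :=
  [/\ w != [::], all (in_strip h) w, sorted adj w, uniq w
    & trapped (in_strip h) w (last pt0 w)].

Definition xmax (w : seq point) : nat := \max_(p <- w) p.1.
Definition xmin (w : seq point) : nat := \big[minn/xmax w]_(p <- w) p.1.
Definition displacement (w : seq point) : nat := xmax w - xmin w.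

Definition gsaws (h n k : nat) : set (seq point) :=
  [set w | [/\ gsaw h w, head pt0 w = (0, h.-1),
               (size w).-1 = n & displacement w = k]]%classic.

Definition gsaw_gf (h : nat) : fps_xy :=
  FPS (fun n => FPS (fun k => (#|` fset_set (gsaws h n k)|%fset)%:R%R)).

Notation fr_path := (seq point).
Notation segment := (seq fr_path).
Notation raw_frame := (seq segment).

Definition points (F : raw_frame) : seq point := flatten (flatten F).

Definition is_path (p : fr_path) : bool := (p != [::]) && sorted adj p.
Definition is_segment (S : segment) : bool := (S != [::]) && all is_path S.

Definition in_grid (w h : nat) : pred point :=
  fun p => (p.1 < w) && (p.2 < h).

(* A frame of width w spans w columns: each of them contains a vertex. In
   particular, an extended frame really uses the new column, so that the frames
   of finished walks have no outgoing edges. *)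
Definition is_frame (w h : nat) (F : raw_frame) : bool :=
  [&& all is_segment F, uniq (points F), all (in_grid w h) (points F)
    & all (fun c => c \in [seq p.1 | p <- points F]) (iota 0 w)].

Record frame (w h : nat) :=
  Frame { frame_val :> raw_frame; _ : is_frame w h frame_val }.

Section FrameFinite.

Fixpoint bounded_seqs (T : Type) (N : nat) (s : seq T) : seq (seq T) :=
  if N is N'.+1 then
    [::] :: flatten [seq [seq x :: t | t <- bounded_seqs N' s] | x <- s]
  else [:: [::]].

Lemma mem_bounded_seqs (T : eqType) N (s t : seq T) :
  size t <= N -> all (fun x => x \in s) t -> t \in bounded_seqs N s.
Proof.
elim: N t => [|N IHN] [|x t] //=; rewrite ltnS => szt /andP[xs ts].
rewrite inE /=; apply/flatten_mapP; exists x => //.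
by apply: map_f; apply: IHN.
Qed.

Lemma size_flatten_ge (T : eqType) (ss : seq (seq T)) :
  all (fun s => s != [::]) ss -> size ss <= size (flatten ss).
Proof.
elim: ss => //= s ss IHss /andP[]; case: s => // x s _ /IHss le.
by rewrite /= size_cat ltnS (leq_trans le) // leq_addl.
Qed.

Lemma size_mem_flatten (T : eqType) (ss : seq (seq T)) s :
  s \in ss -> size s <= size (flatten ss).
Proof.
elim: ss => //= s' ss IHss; rewrite inE size_cat => /orP[/eqP->|/IHss le].
  exact: leq_addr.
by rewrite (leq_trans le) // leq_addl.
Qed.

Variables w h : nat.

HB.instance Definition _ := [isSub of frame w h for @frame_val w h].
HB.instance Definition _ := [Countable of frame w h by <:].

Let grid : seq point := [seq (c, r) | c <- iota 0 w, r <- iota 0 h].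
Let raw_frames : seq raw_frame :=
  bounded_seqs (w * h) (bounded_seqs (w * h) (bounded_seqs (w * h) grid)).

Lemma frame_in_raw_frames (F : frame w h) : frame_val F \in raw_frames.
Proof.
case: F => F /= /and4P[segF uniqF gridF _].
have inG : {subset points F <= grid}.
  move=> [c r] /(allP gridF) /andP[/= cw rh].
  by apply/allpairsP; exists (c, r); rewrite /= !mem_iota !add0n.
have szP : size (flatten (flatten F)) <= w * h.
  rewrite -[X in _ <= X * _](size_iota 0) -[X in _ <= _ * X](size_iota 0).
  by rewrite -(size_allpairs pair); apply: (uniq_leq_size uniqF inG).
have neF : all (fun S => S != [::]) F.
  by apply: sub_all segF => S /andP[].
have neS : all (fun p => p != [::]) (flatten F).
  apply/allP => p /flattenP[S SF pS].
  by have /andP[_ /allP/(_ p pS)/andP[]] := allP segF S SF.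
have szS : size (flatten F) <= w * h.
  exact: leq_trans (size_flatten_ge neS) szP.
apply: mem_bounded_seqs.
  exact: leq_trans (size_flatten_ge neF) szS.
apply/allP => S SF; apply: mem_bounded_seqs.
  exact: leq_trans (size_mem_flatten SF) szS.
apply/allP => p pS.
have pF : p \in flatten F by apply/flattenP; exists S.
apply: mem_bounded_seqs.
  exact: leq_trans (size_mem_flatten pF) szP.
by apply/allP => v vp; apply: inG; apply/flattenP; exists p.
Qed.

Lemma frame_enumP :
  Finite.axiom (undup (pmap insub raw_frames : seq (frame w h))).
Proof.
apply: Finite.uniq_enumP (undup_uniq _) _ => F.
by rewrite mem_undup mem_pmap_sub frame_in_raw_frames.
Qed.

HB.instance Definition _ := isFinite.Build (frame w h) frame_enumP.

End FrameFinite.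

Definition seg_start (S : segment) : point := head pt0 (head [::] S).
Definition seg_end (S : segment) : point := last pt0 (last [::] S).
Definition last_seg (F : raw_frame) : segment := last [::] F.
Definition nth_seg (F : raw_frame) (i : nat) : segment := nth [::] F i.
Definition single_point (S : segment) : bool := size (flatten S) == 1.

Definition n_edges (F : raw_frame) : nat :=
  \sum_(S <- F) \sum_(p <- S) (size p).-1.

(* In a frame, trapped refers to the neighbours lying in the w columns of the
   frame. *)
Definition frame_trapped (w h : nat) (F : raw_frame) : Prop :=
  trapped (in_grid w h) (points F) (seg_end (last_seg F)).

Definition valid_first_frame (h : nat) (F : raw_frame) : Prop :=
  [/\ forall i, i < size F -> size (nth_seg F i) = 1,
      forall i, i.+1 < size F -> ~~ single_point (nth_seg F i),
      seg_start (nth_seg F 0) = (0, h.-1),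
      (forall i, 0 < i < size F -> (seg_start (nth_seg F i)).1 = 1) /\
      (forall i, i.+1 < size F -> (seg_end (nth_seg F i)).1 = 1)
    & ((seg_end (last_seg F)).1 = 0 -> frame_trapped 2 h F) /\
      (single_point (last_seg F) -> (seg_end (last_seg F)).1 = 1 ->
       frame_trapped 2 h F)].

(* Columns 0 and 1 are those of the frame, column 2 is the new one. *)

Definition extendable (F : raw_frame) : Prop :=
  (forall i, 0 < i < size F -> (seg_start (nth_seg F i)).1 = 1) /\
  (forall i, i.+1 < size F -> (seg_end (nth_seg F i)).1 = 1).

(* A possibly empty vertical path in column 2; as the vertices of an extended
   frame are distinct, it goes either upward or downward. *)
Definition new_run (r : fr_path) : bool :=
  sorted adj r && all (fun p => p.1 == 2) r.

Definition right_of (p : point) : point := (p.1.+1, p.2).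

Definition prepend (a : fr_path) (S : segment) : segment :=
  if S is p :: S' then (a ++ p) :: S' else [::].
Definition append (S : segment) (b : fr_path) : segment :=
  if S is p :: S' then rcons (belast p S') (last p S' ++ b) else [::].

(* The run a leads to the start of S and the run b leaves from its end. *)
Definition extends_seg (is_first is_last : bool) (S T : segment) : Prop :=
  exists a b : fr_path,
    [/\ T = append (prepend a S) b, new_run a && new_run b,
        if is_first then a = [::]
        else a != [::] /\ last pt0 a = right_of (seg_start S)
      & (b = [::] /\ is_last) \/
        (b != [::] /\ head pt0 b = right_of (seg_end S))].

Definition extends_segs (F Y : raw_frame) : Prop :=
  size Y = size F /\
  forall i, i < size F ->
    extends_seg (i == 0) (i.+1 == size F) (nth_seg F i) (nth_seg Y i).

(* Some segments are joined to the next one by a new edge. *)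
Inductive merges : raw_frame -> raw_frame -> Prop :=
| MergesNil : merges [::] [::]
| MergesKeep S Y Z : merges Y Z -> merges (S :: Y) (S :: Z)
| MergesJoin S p q T Y Z :
    adj (last pt0 p) (head pt0 q) ->
    merges ((S ++ (p ++ q) :: T) :: Y) Z ->
    merges (rcons S p :: (q :: T) :: Y) Z.

Definition new_segment (is_last : bool) (S : segment) : Prop :=
  exists c : fr_path,
    [/\ S = [:: c], c != [::], new_run c & is_last || (1 < size c)].

(* The mask m is true at the positions of the old segments. *)
Definition inserts (Z X : raw_frame) : Prop :=
  exists m : bitseq,
    [/\ size m = size X, mask m X = Z, head true m,
        forall i, i < size X -> ~~ nth true m i ->
          new_segment (i.+1 == size X) (nth_seg X i)
      & ~~ last true m -> (seg_end (last_seg Z)).1 = 2].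

Definition extension (h : nat) (F X : raw_frame) : Prop :=
  [/\ extendable F, is_frame 3 h X
    & exists Y Z, [/\ extends_segs F Y, merges Y Z & inserts Z X]].

(* Only an end in column 1 or 2 is tested. An end in column 0 either was tested
   when its column was the middle one (or in the first frame), or is not the
   end of the walk but the last point before the walk leaves for a trimmed
   column, in which case it need not be trapped. *)
Definition removed (h : nat) (X : raw_frame) : Prop :=
  ~ frame_trapped 3 h X /\
  ((seg_end (last_seg X)).1 = 1 \/
   (single_point (last_seg X) /\ (seg_end (last_seg X)).1 = 2)).

(* Cut a path at its vertices in column 0 and shift the pieces to the left;
   cur is the current piece. *)
Fixpoint cut_path (cur : fr_path) (p : fr_path) : seq fr_path :=
  if p is v :: p' then
    if v.1 == 0 then cur :: cut_path [::] p'
    else cut_path (rcons cur (v.1.-1, v.2)) p'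
  else [:: cur].

Definition trim_seg (S : segment) : segment :=
  [seq p <- flatten (map (cut_path [::]) S) | p != [::]].
Definition trim (X : raw_frame) : raw_frame := map trim_seg X.

(* None is the start vertex. *)
Notation Dvertex h := (option (frame 2 h)).

(* There is an edge of weight x^n y from u to v. *)
Definition is_Dedge (h : nat) (u v : Dvertex h) (n : nat) : Prop :=
  match u, v with
  | None, Some F => valid_first_frame h F /\ n = n_edges F
  | Some F, Some F' =>
      exists X : raw_frame,
        [/\ extension h F X, ~ removed h X, trim X = F'
          & n = n_edges X - n_edges F]
  | _, None => False
  end.

(* The bound on n only serves to obtain a finite type: a frame of width at most
   3 has at most 3 * h edges. *)
Definition Dedge (h : nat) :=
  {e : Dvertex h * Dvertex h * 'I_(3 * h).+1
     | `[< is_Dedge e.1.1 e.1.2 e.2 >]}.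

Definition D (h : nat) : wdigraph fps_xy :=
  @WDigraph fps_xy (Dvertex h) (Dedge h)
    (fun e => (val e).1.1) (fun e => (val e).1.2)
    (fun e => (fps_x ^+ (val e).2 * fps_y)%R).

Definition Dstart (h : nat) : vertex (D h) := None.

Definition Daccepting (h : nat) : pred (vertex (D h)) :=
  fun u : Dvertex h =>
    if u is Some F then (size F == 1) && ((seg_end (last_seg F)).1 == 0)
    else false.

Definition accepted_walks (h n k : nat) : set (seq (edge (D h))) :=
  [set p | exists t, [/\ Daccepting t, is_walk (Dstart h) p t
                       & walk_weight p = (fps_x ^+ n * fps_y ^+ k)%R]]%classic.

Arguments accepted_walks : clear implicits.

(* Main.v *)
Require Import Defs.
From HB Require Import structures.
From mathcomp Require Import all_boot all_order all_algebra finmap zify.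
From mathcomp Require Import boolp classical_sets functions cardinality.

(* A walk restricted to the columns [0, ..., j] falls into maximal pieces; this
   list of pieces, in the order of traversal, is a configuration, and the j-th
   frame of the walk is the view of the j-th configuration through the window of
   columns j - 1 and j. Cutting into pieces is compatible with composition of
   windows and, where a cut does not separate neighbours, with concatenation, so
   an extension of the view of a configuration is exactly the view of a
   configuration with one more column. Hence the walks in [D h] are the
   sequences of views of the successive configurations of a walk; a walk is
   recovered from its frames because each of its edges lies in some window. As
   every edge of [D h] carries a factor y, I - M is invertible modulo y, and only
   the k-th power of M contributes to the coefficient of y^k. *)

Set Implicit Arguments.
Unset Strict Implicit.
Unset Printing Implicit Defensive.

(** What a configuration must record is decided at its boundary column [j]. A piece followed by
    another one ends in column [j], since the walk leaves it to the right, and every piece but the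
    first starts there. If the last piece ends left of column [j], or is a single point, the walk
    cannot go on, so its end must be trapped; a longer last piece ending in column [j] may or may
    not be continued, and the decision is postponed until the next column is present. The trapping
    clauses of [config] and of [removed] are two forms of this rule. The obstacle is that an
    extension consists of three relations on frames (extending, merging, inserting), whereas adding
    a column to a configuration is a single act. In one direction the larger configuration has to be
    taken apart along its runs in the new column, pieces lying wholly in that column being the
    inserted ones. In the other direction the three stages are lifted one at a time, under
    invariants that keep the intermediate lists of pieces close to configurations. *)

Local Notation point := (nat * nat)%type.

(** * Maximal runs of a sequence *)

Section Pieces.
Variable T : eqType.
Implicit Types (P Q : pred T) (s t u v : seq T).

Definition head_in P s := if s is x :: _ then P x else false.

Fixpoint pieces P s : seq (seq T) :=
  if s is x :: s' then
    if P x then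
      if head_in P s' then
        (x :: head [::] (pieces P s')) :: behead (pieces P s')
      else [:: x] :: pieces P s'
    else pieces P s'
  else [::].

Definition pairs s := zip s (behead s).
Definition both P (xy : T * T) := P xy.1 && P xy.2.

Lemma pieces_consP P y s :
  P y -> exists q L, pieces P (y :: s) = (y :: q) :: L.
Proof. by move=> /= ->; case: (head_in P s); eexists; eexists. Qed.

Variant pieces_cons_spec P x s : seq (seq T) -> Prop :=
| PiecesOut of P x = false : pieces_cons_spec P x s (pieces P s)
| PiecesNew of P x & ~~ head_in P s :
    pieces_cons_spec P x s ([:: x] :: pieces P s)
| PiecesGrow y s' q L of P x & s = y :: s' & P y
    & pieces P s = (y :: q) :: L :
    pieces_cons_spec P x s ((x :: y :: q) :: L).

Lemma pieces_consE P x s : pieces_cons_spec P x s (pieces P (x :: s)).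
Proof.
rewrite /=; case Px: (P x); last by constructor.
case Hs: (head_in P s); last by constructor; rewrite ?Hs.
case: s Hs => //= y s Py.
have [q [L e]] := @pieces_consP P y s Py; move: (e) => /= ->.
by apply: PiecesGrow => //; exact: e.
Qed.

Lemma pieces_cons0 P x s : ~~ head_in P s ->
  pieces P (x :: s) = (if P x then [:: [:: x]] else [::]) ++ pieces P s.
Proof. by move=> /negbTE /= ->; case: (P x). Qed.

Lemma pieces_cons1 P x y s q L : P x -> P y ->
  pieces P (y :: s) = q :: L -> pieces P (x :: y :: s) = (x :: q) :: L.
Proof. by move=> Px Py e; rewrite [LHS]/= -/(pieces P (y :: s)) e Px /= Py. Qed.

Lemma flatten_pieces P s : flatten (pieces P s) = filter P s.
Proof.
elim: s => // x s IHs; rewrite [RHS]/= -IHs.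
by case: pieces_consE => [->|->|y s' q L -> _ _ ->].
Qed.

Lemma eq_in_pieces P Q s : {in s, P =1 Q} -> pieces P s = pieces Q s.
Proof.
elim: s => //= x s IHs eqPQ.
rewrite -(eqPQ x (mem_head _ _)) IHs; last first.
  by move=> z zs; apply: eqPQ; rewrite inE zs orbT.
case: (P x) => //; case: s {IHs} eqPQ => //= y s eqPQ.
by rewrite -(eqPQ y) // !inE eqxx orbT.
Qed.

Lemma pieces_nonempty P s : all (fun q => q != [::]) (pieces P s).
Proof.
elim: s => // x s IHs.
by case: pieces_consE => // y s' q L _ _ _ e; move: IHs; rewrite e.
Qed.

Lemma pieces_none P s : ~~ has P s -> pieces P s = [::].
Proof. by elim: s => //= x s IHs; case: (P x). Qed.

Lemma pieces_all P s : s != [::] -> all P s -> pieces P s = [:: s].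
Proof.
elim: s => // x [|y s] IHs _ /andP[/= Px Ps]; first by rewrite Px.
have /andP[Py _] := Ps; exact: (pieces_cons1 Px Py (IHs isT Ps)).
Qed.

Lemma pieces_eq0 P s : (pieces P s == [::]) = ~~ has P s.
Proof.
apply/idP/idP => [|/pieces_none -> //].
rewrite has_filter -flatten_pieces negbK => /eqP -> //.
Qed.

Lemma pieces_pairs P s :
  flatten (map pairs (pieces P s)) = filter (both P) (pairs s).
Proof.
elim: s => // x s IHs.
case: pieces_consE => [Px|Px|y s' q L Px es Py e].
- by rewrite IHs; case: s {IHs} => //= y s; rewrite /both /= Px.
- rewrite /= IHs; case: s {IHs} => //= y s /negbTE.
  by rewrite /both /= => ->; rewrite andbF.
- by move: IHs; rewrite e es /= /both /= Px Py /= => <-.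
Qed.

Lemma pieces_cat_sep P s t : ~~ (head_in P (rev s) && head_in P t) ->
  pieces P (s ++ t) = pieces P s ++ pieces P t.
Proof.
elim: s => // x [|y s] IHs sep; rewrite cat_cons.
  move: sep; rewrite /= => sep; case Px: (P x) => //.
  by move: sep; rewrite Px /= => /negbTE ->.
have {}IHs : pieces P ((y :: s) ++ t) = pieces P (y :: s) ++ pieces P t.
  apply: IHs; move: sep; rewrite rev_cons.
  by case E: (rev (y :: s)) => //; move/(congr1 size): E; rewrite size_rev.
case: (pieces_consE P x (y :: s)) => [Px|Px Hy|y' s' q L Px [<- _] Py e].
- by rewrite [LHS]/= Px.
- by rewrite pieces_cons0 // IHs Px.
- by rewrite (pieces_cons1 (L := L ++ pieces P t) (q := y :: q)) // IHs e.
Qed.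

(** The complement of [pieces_cat_sep]: here a run crosses the junction. The variables follow the
    shape of [MergesJoin], where the last path of a segment is joined to the first path of the
    next. *)
Lemma pieces_cat_glue P s t S p q L :
    head_in P (rev s) -> head_in P t ->
    pieces P s = rcons S p -> pieces P t = q :: L ->
  pieces P (s ++ t) = S ++ (p ++ q) :: L.
Proof.
move=> + Pt + et; case: t Pt et => // z t Pz et.
elim: s S p => // x [|y s] IHs S p Hs; rewrite cat_cons.
  rewrite /= in Hs; rewrite [pieces P [:: x]]/= Hs.
  case: S => [[<-]|? []//]; exact: (pieces_cons1 Hs Pz et).
have {}IHs S' p' : pieces P (y :: s) = rcons S' p' ->
    pieces P ((y :: s) ++ z :: t) = S' ++ (p' ++ q) :: L.
  apply: IHs; move: Hs; rewrite rev_cons.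
  by case E: (rev (y :: s)) => //; move/(congr1 size): E; rewrite size_rev.
case: (pieces_consE P x (y :: s)) => [Px|Px Hy|y' s' q' L' Px [<- _] Py e] eS.
- by rewrite [LHS]/= Px; apply: IHs.
- rewrite pieces_cons0 // Px; case: S eS => [|p0 S] [].
    move=> _ E0; have /eqP : pieces P (y :: s) = [::] := E0.
    rewrite pieces_eq0 -has_rev => /negP[]; move: Hs; rewrite rev_cons.
    by case E: (rev (y :: s)) => [|c r] /=;
      [move/(congr1 size): E; rewrite size_rev|move=> ->].
  by move=> <- eS; rewrite (IHs _ _ eS).
- case: S eS => [|p0 S] [].
    move=> <- e0; have := IHs [::] (y :: q'); rewrite e e0 => /(_ erefl) /= E.
    exact: (pieces_cons1 Px Py E).
  move=> <- e0; have := IHs ((y :: q') :: S) p; rewrite e e0 => /(_ erefl) E.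
  exact: (pieces_cons1 Px Py E).
Qed.

Lemma pieces_pieces P Q s : subpred Q P ->
  flatten (map (pieces Q) (pieces P s)) = pieces Q s.
Proof.
move=> QP; elim: s => // x s IHs.
case: (pieces_consE P x s) => [Px|Px Hs|y s' q L Px es Py e].
- by rewrite IHs /=; case Qx: (Q x) => //; move/QP: Qx; rewrite Px.
- have H0 : ~~ head_in Q s by case: s Hs {IHs} => //= y s; apply/contra/QP.
  by rewrite (pieces_cons0 x H0) /= IHs.
- rewrite {}e {}es in IHs *; set R := flatten (map (pieces Q) L).
  have {}IHs : pieces Q (y :: q) ++ R = pieces Q (y :: s') := IHs.
  change (pieces Q (x :: y :: q) ++ R = pieces Q (x :: y :: s')).
  case Qy: (Q y); last first.
    have H0 v : ~~ head_in Q (y :: v) by rewrite /head_in Qy.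
    by rewrite (pieces_cons0 x (H0 q)) (pieces_cons0 x (H0 s')) -IHs catA.
  case Qx: (Q x); last by rewrite /= Qx.
  have [q1 [L1 eq1]] := @pieces_consP Q y q Qy; rewrite eq1 in IHs.
  by rewrite (pieces_cons1 Qx Qy eq1) (pieces_cons1 Qx Qy (esym IHs)).
Qed.

Lemma mem_pieces P s q : q \in pieces P s -> q != [::] /\ all P q.
Proof.
move=> qs; split; first exact: (allP (pieces_nonempty P s)).
apply/allP => x xq; have : x \in flatten (pieces P s).
  by apply/flattenP; exists q.
by rewrite flatten_pieces mem_filter => /andP[].
Qed.

(** The two [head_in] conditions express the maximality of the run; for a walk they locate its
    crossings of the boundary column before and after a piece. *)
Lemma pieces_split P s L1 q L2 : pieces P s = L1 ++ q :: L2 ->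
  exists u v, [/\ s = u ++ q ++ v, pieces P u = L1, pieces P v = L2,
     ~~ head_in P (rev u) & ~~ head_in P v].
Proof.
elim: s L1 q => [[]//|x s IHs] L1 q.
case: (pieces_consE P x s) => [Px|Px Hs|y s' q' L Px es Py e].
- move=> /IHs[u [v [-> Lu Lv Hu Hv]]]; exists (x :: u), v; split => //.
    by rewrite /= Px.
  by rewrite rev_cons; case: (rev u) Hu => //=; rewrite Px.
- case: L1 => [[<- eL2]|q1 L1 [<-] e].
    by exists [::], s; split.
  have [qn qP] : q != [::] /\ all P q.
    by apply: (@mem_pieces P s); rewrite e mem_cat mem_head orbT.
  have [u [v [es Lu Lv Hu Hv]]] := IHs _ _ e.
  case: u es Lu Hu => [|z u] es Lu Hu.
    by move: Hs; rewrite es; case: (q) qn qP => //= z q0 _ /andP[->].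
  exists (x :: z :: u), v; split => //; first by rewrite es.
    by rewrite pieces_cons0 ?Px ?Lu //; move: Hs; rewrite es.
  rewrite rev_cons; case E: (rev (z :: u)) Hu => //.
  by move/(congr1 size): E; rewrite size_rev.
- case: L1 => [[<- eL2]|q1 L1 [<-] eL].
    rewrite e in IHs; have [u [v [es' Lu Lv Hu Hv]]] :=
      IHs [::] (y :: q') (congr1 (cons (y :: q')) eL2).
    case: u es' Lu Hu => [|z u] es' Lu Hu; first by exists [::], v; rewrite es'.
    by move/eqP: Lu; rewrite pieces_eq0 /=; move: es'; rewrite es => -[<- _];
       rewrite Py.
  rewrite e eL in IHs.
  have [u [v [es' Lu Lv Hu Hv]]] := IHs ((y :: q') :: L1) q erefl.
  case: u es' Lu Hu => [|z u] es' Lu Hu; first by move: Lu.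
  exists (x :: z :: u), v; split => //; first by rewrite es'.
    apply: (pieces_cons1 Px _ Lu).
    by move: es'; rewrite es => -[<- _].
  rewrite rev_cons; case E: (rev (z :: u)) Hu => //.
  by move/(congr1 size): E; rewrite size_rev.
Qed.

Lemma sorted_pairs (e : rel T) s : sorted e s = all (fun xy => e xy.1 xy.2) (pairs s).
Proof. by case: s => // x s; elim: s x => //= y s IHs x; rewrite IHs. Qed.

Lemma sorted_pieces (e : rel T) P s : sorted e s -> all (sorted e) (pieces P s).
Proof.
rewrite sorted_pairs => es; apply/allP => q qs; rewrite sorted_pairs.
apply/allP => xy xyq; apply: (allP es).
have : xy \in flatten (map pairs (pieces P s)).
  by apply/flattenP; exists (pairs q) => //; apply: map_f.
by rewrite pieces_pairs mem_filter => /andP[].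
Qed.

Lemma size_pairs s : size (pairs s) = (size s).-1.
Proof. by rewrite size_zip size_behead; exact/minn_idPr/leq_pred. Qed.

End Pieces.

Lemma pieces_map (T U : eqType) (f : T -> U) (P : pred U) s :
  pieces P (map f s) = map (map f) (pieces (P \o f) s).
Proof.
elim: s => // x s IHs; rewrite /= IHs.
have -> : head_in P (map f s) = head_in (P \o f) s by case: s {IHs}.
by case: (P (f x)) => //; case: (head_in _ s) => //; case: (pieces _ s).
Qed.

Lemma pairs_map (T U : eqType) (f : T -> U) s :
  pairs (map f s) = map (fun xy => (f xy.1, f xy.2)) (pairs s).
Proof. by elim: s => // x [|y s] // IHs; congr (_ :: _). Qed.

Lemma mem_pairs (T : eqType) (a b : T) s :
  (a, b) \in pairs s -> a \in s /\ b \in s.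
Proof.
elim: s => // x [|y s] // IHs; rewrite [pairs _]/= inE => /orP[/eqP[-> ->]|/IHs[as_ bs]].
  by split; rewrite !inE eqxx ?orbT.
by split; apply/orP; right.
Qed.

(** Without repetitions the only pair starting at [x] is the first one, so the set of pairs
    determines the successor of [x]; removing this pair leaves the pairs of the tails. *)
Lemma eq_from_pairs (T : eqType) (x : T) s t : uniq (x :: s) -> uniq (x :: t) ->
  pairs (x :: s) =i pairs (x :: t) -> s = t.
Proof.
elim: s x t => [|y s IHs] x [|z t] // Us Ut est.
- by have := est (x, z); rewrite /= mem_head.
- by have := est (x, y); rewrite /= mem_head.
have memp (u : seq T) w a b : (a, b) \in pairs (w :: u) -> a \in w :: u.
  by case/mem_pairs.
have eyz : y = z.
  have : (x, y) \in pairs (x :: z :: t) by rewrite -est mem_head.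
  rewrite inE => /orP[/eqP[]//|/memp xt].
  by move: Ut; rewrite /= xt.
rewrite -{z}eyz in Ut est *; congr (_ :: _).
apply: (IHs y); [by case/andP: Us|by case/andP: Ut|] => -[a b].
have := est (a, b); rewrite !inE; case: eqP => //= -[-> ->].
by move=> _; apply/idP/idP => /memp xt; move: Us Ut; rewrite /= xt.
Qed.

(** * Windows on a configuration *)

Lemma head_in_rev (T : eqType) (P : pred T) x0 s :
  s != [::] -> head_in P (rev s) = P (last x0 s).
Proof. by case/lastP: s => // s x _; rewrite rev_rcons last_rcons. Qed.

Lemma head_inE (T : eqType) (P : pred T) x0 s :
  s != [::] -> head_in P s = P (head x0 s).
Proof. by case: s. Qed.

Definition from (m : nat) : pred point := fun v => m <= v.1.
Definition upto (j : nat) : pred point := fun v => v.1 <= j.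
Arguments from : simpl never.
Arguments upto : simpl never.
Definition shift (m : nat) (v : point) : point := (v.1 - m, v.2).

(** A piece gives one segment, since its points are joined by edges in the columns seen so far; its
    runs inside the window are the paths of that segment. *)
Definition view_path (m : nat) (p : seq point) : segment :=
  map (map (shift m)) (pieces (from m) p).
Definition view (m : nat) (C : seq (seq point)) : raw_frame :=
  map (view_path m) C.
(** In contrast to [view], the runs of a piece are not kept together: columns removed on the right
    no longer connect them, whereas columns hidden on the left still do. *)
Definition clip (j : nat) (C : seq (seq point)) : seq (seq point) :=
  flatten (map (pieces (upto j)) C).

Definition steps (C : seq (seq point)) := flatten (map (@pairs _) C).

Lemma shift_inj m v v' : from m v -> from m v' -> shift m v = shift m v' -> v = v'.
Proof. by case: v v' => [a b] [a' b']; rewrite /from /= => ? ? [? ->]; congr (_, _); lia. Qed.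

Lemma adj_shift m v v' : from m v -> from m v' ->
  adj (shift m v) (shift m v') = adj v v'.
Proof. by rewrite /from /adj /distn1 /= => ? ?; apply/idP/idP; lia. Qed.

Lemma shift_shift m n v : shift n (shift m v) = shift (m + n) v.
Proof. by rewrite /shift /= subnDA. Qed.

Lemma sorted_adj_shift m p : all (from m) p ->
  sorted adj (map (shift m) p) = sorted adj p.
Proof.
elim: p => // v [|v' p] IHp // /and3P[mv mv' mp].
have {}IHp := IHp (introT andP (conj mv' mp)).
by rewrite [LHS]/= adj_shift // [in RHS]/=; congr (_ && _).
Qed.

Lemma flatten_view_path m p :
  flatten (view_path m p) = map (shift m) (filter (from m) p).
Proof. by rewrite /view_path -map_flatten flatten_pieces. Qed.

Lemma points_view m C :
  points (view m C) = map (shift m) (filter (from m) (flatten C)).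
Proof.
rewrite /points /view; elim: C => //= p C IHC.
by rewrite flatten_cat IHC flatten_view_path filter_cat map_cat.
Qed.

Lemma flatten_clip j C : flatten (clip j C) = filter (upto j) (flatten C).
Proof.
by elim: C => //= p C IHC; rewrite /clip /= flatten_cat flatten_pieces filter_cat -IHC.
Qed.

Lemma clip_clip i j C : i <= j -> clip i (clip j C) = clip i C.
Proof.
move=> ij; elim: C => //= p C IHC; rewrite /clip /= map_cat flatten_cat.
by rewrite pieces_pieces 1?[X in _ ++ X]IHC // => v /leq_trans; apply.
Qed.

Lemma clip_id j C : all is_path C -> all (upto j) (flatten C) ->
  clip j C = C.
Proof.
elim: C => //= p C IHC /andP[/andP[p0 _] Cp]; rewrite all_cat => /andP[pj Cj].
by rewrite /clip /= pieces_all // [X in _ ++ X]IHC.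
Qed.

Lemma steps_clip j C : steps (clip j C) = filter (both (upto j)) (steps C).
Proof.
elim: C => //= p C IHC; rewrite /clip /steps /= map_cat flatten_cat filter_cat.
by rewrite pieces_pairs [X in _ ++ X]IHC.
Qed.

Lemma steps_view m C : steps (flatten (view m C)) =
  map (fun xy => (shift m xy.1, shift m xy.2)) (filter (both (from m)) (steps C)).
Proof.
elim: C => //= p C IHC; rewrite /steps /= map_cat flatten_cat.
rewrite filter_cat map_cat [X in _ ++ X]IHC; congr (_ ++ _).
rewrite /view_path -pieces_pairs map_flatten -!map_comp; congr flatten.
by apply: eq_map => q /=; rewrite pairs_map.
Qed.

Lemma n_edgesE F : n_edges F = size (steps (flatten F)).
Proof.
rewrite /n_edges /steps size_flatten /shape -map_comp sumnE big_map.
by rewrite big_flatten /=; apply: eq_bigr => S _; apply: eq_bigr => p _;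
   rewrite size_pairs.
Qed.

Lemma n_edges_view m C : n_edges (view m C) = count (both (from m)) (steps C).
Proof. by rewrite n_edgesE steps_view size_map size_filter. Qed.

Lemma steps_adj C : all is_path C -> all (fun xy => adj xy.1 xy.2) (steps C).
Proof.
elim: C => //= p C IHC /andP[/andP[_]]; rewrite sorted_pairs /steps /= all_cat.
by move=> -> /IHC.
Qed.

(** Inclusion and exclusion: an edge meets at most two neighbouring columns, so it lies in the
    columns up to [m.+1] or in those from [m] on, and the edges lying in both are those of the old
    frame. Hence [n_edges X - n_edges F] is the number of new edges. *)
Lemma n_edges_step m C : all is_path C -> all (upto m.+2) (flatten C) ->
  size (steps C) = size (steps (clip m.+1 C)) +
     (n_edges (view m C) - n_edges (view m (clip m.+1 C))).
Proof.
move=> Cp Cm; rewrite !n_edges_view steps_clip size_filter count_filter.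
set c1 := count (both (upto _)) _; set c2 := count (both (from _)) _.
have -> : count (predI (both (from m)) (both (upto m.+1))) (steps C) =
          c1 + c2 - size (steps C).
  rewrite /c1 /c2 -count_predUI.
  have -> : count (predU (both (upto m.+1)) (both (from m))) (steps C) = size (steps C).
    apply/eqP; rewrite -all_count; apply: sub_all (steps_adj Cp) => -[v v'].
    by rewrite /both /= /adj /distn1 /upto /from; lia.
  by rewrite addKn; apply: eq_count => v /=; rewrite andbC.
have le1 : c1 <= size (steps C) by apply: count_size.
have le2 : c2 <= size (steps C) by apply: count_size.
have : size (steps C) <= c1 + c2.
  rewrite /c1 /c2 -count_predUI -[X in X <= _]addn0 leq_add //.
  rewrite -size_filter -[X in X <= _]/(size (steps C)) size_filter.
  suff -> : count (predU (both (upto m.+1)) (both (from m))) (steps C) =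
            size (steps C) by [].
  apply/eqP; rewrite -all_count; apply: sub_all (steps_adj Cp) => -[v v'].
  by rewrite /both /= /adj /distn1 /upto /from; lia.
lia.
Qed.

(** [cut_path] stores its current piece already shifted and may emit empty pieces; so [cur] is a
    preimage of the accumulator, and the filter restores the nonempty runs. *)
Lemma cut_path_pieces cur p : all (from 1) cur ->
  [seq q <- cut_path (map (shift 1) cur) p | q != [::]] =
  view_path 1 (cur ++ p).
Proof.
elim: p cur => [|v p IHp] cur c1; rewrite [cut_path _ _]/=.
  rewrite /= cats0 /view_path; case: cur c1 => // x cur c1.
  by rewrite pieces_all.
case: eqP => v0.
  rewrite /= -[X in cut_path X]/(map (shift 1) [::]) IHp // /view_path.
  have sep : ~~ (head_in (from 1) (rev cur) && head_in (from 1) (v :: p)).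
    by rewrite negb_and /= /from v0 orbT.
  rewrite (pieces_cat_sep sep) map_cat /= /from v0 /=.
  by case: cur c1 {sep} => // x cur c1; rewrite (@pieces_all _ _ (x :: cur)).
rewrite -cat_rcons -IHp; first by rewrite map_rcons /shift subn1.
by rewrite all_rcons c1 /from; lia.
Qed.

Lemma trim_view m C : trim (view m C) = view m.+1 C.
Proof.
rewrite /trim /view -map_comp; apply: eq_map => p /=; rewrite /trim_seg.
rewrite filter_flatten -map_comp.
transitivity (flatten (map (view_path 1) (view_path m p))).
  by congr flatten; apply: eq_map => q /=; rewrite (@cut_path_pieces [::]).
rewrite /view_path -(pieces_pieces (P := from m) (Q := from m.+1)); last first.
  by move=> v; rewrite /from; lia.
rewrite map_flatten -!map_comp; congr flatten.
apply/eq_in_map => q /mem_pieces[_ mq] /=.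
rewrite pieces_map -map_comp (eq_in_pieces (Q := from m.+1)).
  by apply: eq_map => r /=; rewrite -map_comp; apply: eq_map => v /=;
     rewrite shift_shift addn1.
by move=> v /(allP mq); rewrite /from /=; lia.
Qed.

Lemma view_path_join m s t S p q T :
    head_in (from m) (rev s) -> head_in (from m) t ->
    view_path m s = rcons S p -> view_path m t = q :: T ->
  view_path m (s ++ t) = S ++ (p ++ q) :: T.
Proof.
move=> sm tm; rewrite /view_path.
case/lastP E: (pieces (from m) s) => [|S0 p0]; first by case: S.
case Et: (pieces (from m) t) => [//|q0 T0].
rewrite map_rcons => /rcons_inj[<- <-] [<- <-].
by rewrite (pieces_cat_glue sm tm E Et) map_cat /= map_cat.
Qed.

Lemma view_path_prepend m a s : all (from m) a ->
  (a != [::] -> head_in (from m) s) ->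
  view_path m (a ++ s) = prepend (map (shift m) a) (view_path m s).
Proof.
case: a => [|x a] am sm; first by case: (view_path m s).
have {}sm := sm isT; case: s sm => // y s ym.
have [q [L e]] := @pieces_consP _ (from m) y s ym.
have eq : view_path m (y :: s) = map (shift m) (y :: q) :: map (map (shift m)) L.
  by rewrite /view_path e.
rewrite (view_path_join (S := [::]) (p := map (shift m) (x :: a)) _ _ _ eq) //.
- by rewrite eq.
- by rewrite (head_in_rev _ x) //=; apply: (allP am); apply: mem_last.
- by rewrite /view_path pieces_all.
Qed.

Lemma append_rcons S p b : append (rcons S p) b = rcons S (p ++ b).
Proof.
by case: S => //= q S; rewrite last_rcons belast_rcons.
Qed.

Lemma view_path_append m b s : all (from m) b ->
  (b != [::] -> head_in (from m) (rev s)) ->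
  view_path m (s ++ b) = append (view_path m s) (map (shift m) b).
Proof.
move E: (view_path m s) => V; case/lastP: V E => [|S p] e.
  case: b => [|x b] bm sm; first by rewrite cats0.
  have {}sm := sm isT.
  suff : has (from m) s.
    move=> hs; move/eqP: e; rewrite /view_path -size_eq0 size_map size_eq0.
    by rewrite pieces_eq0 hs.
  by move: sm; rewrite -has_rev; case: (rev s) => //= y r ->.
case: b => [|x b] bm sm; first by rewrite !cats0 e append_rcons cats0.
have join := view_path_join (sm isT) _ e (q := map (shift m) (x :: b)) (T := [::]).
rewrite append_rcons join ?cats1 //.
  by have /andP[] := bm.
by rewrite /view_path pieces_all.
Qed.

Lemma last_flatten (T : eqType) (x : T) ss : all (fun s => s != [::]) ss ->
  last x (flatten ss) = last x (last [::] ss).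
Proof.
elim/last_ind: ss => // ss s IHss; rewrite all_rcons flatten_rcons => /andP[s0 _].
by rewrite last_cat last_rcons; case: s s0.
Qed.

Lemma head_flatten (T : eqType) (x : T) ss : all (fun s => s != [::]) ss ->
  head x (flatten ss) = head x (head [::] ss).
Proof. by case: ss => // -[]. Qed.

Lemma seg_end_view_path m p :
  seg_end (view_path m p) = shift m (last pt0 (filter (from m) p)).
Proof.
rewrite /seg_end -last_flatten; last first.
  rewrite /view_path all_map; apply: sub_all (pieces_nonempty _ _) => q /=.
  by case: q.
by rewrite flatten_view_path -[pt0 in LHS]/(shift m pt0) last_map.
Qed.

Lemma seg_start_view_path m p :
  seg_start (view_path m p) = shift m (head pt0 (filter (from m) p)).
Proof.
rewrite /seg_start -head_flatten; last first.
  rewrite /view_path all_map; apply: sub_all (pieces_nonempty _ _) => q /=.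
  by case: q.
by rewrite flatten_view_path; case: (filter _ p).
Qed.

Lemma head_filter_in (P : pred point) s :
  head_in P s -> head pt0 (filter P s) = head pt0 s.
Proof. by case: s => //= x s ->. Qed.

Lemma last_filter_in (P : pred point) s :
  head_in P (rev s) -> last pt0 (filter P s) = last pt0 s.
Proof.
case/lastP: s => // s x; rewrite rev_rcons filter_rcons /= => ->.
by rewrite !last_rcons.
Qed.

Lemma seg_start_in m p : head_in (from m) p ->
  seg_start (view_path m p) = shift m (head pt0 p).
Proof. by move=> mp; rewrite seg_start_view_path head_filter_in. Qed.

Lemma seg_end_in m p : head_in (from m) (rev p) ->
  seg_end (view_path m p) = shift m (last pt0 p).
Proof. by move=> mp; rewrite seg_end_view_path last_filter_in. Qed.

(* A walk leaves the window through its leftmost column. *)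
Lemma last_window m p : sorted adj p ->
  m < (last pt0 (filter (from m) p)).1 ->
  last pt0 p = last pt0 (filter (from m) p).
Proof.
elim/last_ind: p => // p x IHp; rewrite filter_rcons.
case mx: (from m x); first by rewrite !last_rcons.
case/lastP: p IHp => [//|p y] IHp sp mq.
have [sp' ayx] : sorted adj (rcons p y) /\ adj y x.
  by case: p sp {IHp mq} => [|z p] /=; rewrite ?rcons_path ?last_rcons => /andP[].
have := IHp sp' mq; rewrite last_rcons => ey; move: mq mx ayx; rewrite -ey.
by rewrite /from /adj /distn1; lia.
Qed.

Definition in_col (c : nat) : pred point := fun v => v.1 == c.

Arguments in_col : simpl never.

Lemma in_col_from m k v : in_col (m + k) v -> from m v.
Proof. by rewrite /in_col /from => /eqP ->; exact: leq_addr. Qed.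

Lemma merges_join m s t Y Z :
    head_in (from m) (rev s) -> head_in (from m) t ->
    adj (last pt0 s) (head pt0 t) ->
    merges (view_path m (s ++ t) :: Y) Z ->
  merges (view_path m s :: view_path m t :: Y) Z.
Proof.
move=> sm tm ast.
have := seg_end_in sm; have := seg_start_in tm.
case/lastP E: (view_path m s) => [|S p].
  move/eqP: E; rewrite -size_eq0 size_map size_eq0 pieces_eq0.
  by rewrite -has_rev; case: (rev s) sm => //= y r ->.
case F: (view_path m t) => [|q T].
  move/eqP: F; rewrite -size_eq0 size_map size_eq0 pieces_eq0.
  by case: (t) tm => //= y r ->.
rewrite /seg_start /seg_end last_rcons /= => eq ep mYZ.
rewrite (view_path_join sm tm E F) in mYZ.
constructor => //; rewrite eq ep adj_shift //.
- by case/lastP: (s) sm => // s' z; rewrite rev_rcons last_rcons.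
- by case: (t) tm.
Qed.

(** * Extending a piece by one column *)

Fixpoint all2p (T U : Type) (R : T -> U -> Prop) s t : Prop :=
  match s, t with
  | [::], [::] => True
  | x :: s, y :: t => R x y /\ all2p R s t
  | _, _ => False
  end.

Lemma all2p_cat T U (R : T -> U -> Prop) s1 s2 t1 t2 :
  all2p R s1 t1 -> all2p R s2 t2 -> all2p R (s1 ++ s2) (t1 ++ t2).
Proof.
by elim: s1 t1 => [|x s1 IHs] [|y t1] //= [Rxy /IHs] IH /IH.
Qed.

Lemma all2p_size T U (R : T -> U -> Prop) s t : all2p R s t -> size s = size t.
Proof. by elim: s t => [|x s IHs] [|y t] //= [_ /IHs ->]. Qed.

Lemma all2p_nth T U (R : T -> U -> Prop) x0 y0 s t i :
  all2p R s t -> i < size s -> R (nth x0 s i) (nth y0 t i).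
Proof. by elim: s t i => [|x s IHs] [|y t] [|i] //= [Rxy /IHs] => [_|]; auto. Qed.

Lemma all2p_impl (T : eqType) U (R R' : T -> U -> Prop) s t :
  (forall x y, x \in s -> R x y -> R' x y) -> all2p R s t -> all2p R' s t.
Proof.
elim: s t => [|x s IHs] [|y t] //= RR [Rxy Rst]; split.
  by apply: RR Rxy; rewrite mem_head.
by apply: IHs Rst => x' y' xs; apply: RR; rewrite inE xs orbT.
Qed.

(* [y] is the run [Q] of old points with its extensions in the new column [c];
   [e] is the last point of the walk. *)
Definition extends_path (c : nat) (e : point) (first : bool) (Q y : seq point) :=
  exists a b, [/\ y = a ++ Q ++ b, all (in_col c) a && all (in_col c) b, sorted adj y,
    (a == [::]) = first & b = [::] -> last pt0 Q = e].

Lemma adj_right (v w : point) c : adj v w -> v.1 = c.+1 -> w.1 <= c ->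
  v = right_of w.
Proof.
case: v w => [a b] [a' b']; rewrite /adj /distn1 /right_of /= => ? ? ?.
by congr (_, _); lia.
Qed.

Lemma right_of_inj : injective right_of.
Proof. by move=> [a b] [a' b'] [-> ->]. Qed.

Lemma adjC v w : adj v w = adj w v.
Proof. by apply/idP/idP; rewrite /adj /distn1; lia. Qed.

(* A run of new points between two old pieces has at least two points, because
   the walk would otherwise return to the point it came from; it is cut after
   its first point. *)
Lemma extend_path m s :
    sorted adj s -> uniq s -> all (upto m.+2) s -> has (upto m.+1) s ->
  exists Q Qs y L, [/\ pieces (upto m.+1) s = Q :: Qs,
    extends_path m.+2 (last pt0 s) (head_in (upto m.+1) s) Q y,
    all2p (extends_path m.+2 (last pt0 s) false) Qs L,
    head pt0 y = head pt0 s
    & forall u Y Z, merges Y Z ->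
      merges (view_path m (u ++ y) :: view m L ++ Y) (view_path m (u ++ s) :: Z)].
Proof.
set P := upto m.+1.
have nP v : upto m.+2 v -> ~~ P v -> in_col m.+2 v.
  by rewrite /upto /P /upto /in_col; lia.
elim: s => // x s IHs ss us us2 hs.
have sxs : (s == [::]) || adj x (head pt0 s).
  by case: s ss {IHs us us2 hs} => //= y s /andP[].
have ss' : sorted adj s by apply: path_sorted ss.
have us' : uniq s by case/andP: us.
have [ux us2'] := andP us2.
(* Here [x] is the last old point; everything after it is the run leaving from the end. *)
case hs': (has P s); last first.
  have Px : P x by move: hs; rewrite /= hs' orbF.
  exists [:: x], [::], (x :: s), [::]; split.
  - by rewrite -cat1s pieces_cat_sep ?(pieces_none (negbT hs')) /= ?Px ?cats0 //;
       case: s hs' {IHs ss us us2 hs sxs ss' us' us2'} => //= y s;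
       case: (P y) => //=; rewrite andbF.
  - exists [::], s; split => //; last by move=> ->.
    apply/allP => v vs; apply: nP; first exact: (allP us2').
      by apply: contraFN hs' => Pv; apply/hasP; exists v.
  - by [].
  - by [].
  - by move=> u Y Z; constructor.
have [Q [Qs [y [L [eP [a [b [ey ab sy ea be]]] QL hy mer]]]]] := IHs ss' us' us2' hs'.
have sn : s != [::] by case: (s) hs'.
have [Qn QP] : Q != [::] /\ all P Q.
  by apply: (@mem_pieces _ P s); rewrite eP mem_head.
have yn : y != [::] by rewrite ey; case: (a) => //; case: (Q) Qn.
have els : last pt0 (x :: s) = last pt0 s by case: (s) sn.
rewrite els; rewrite (negbTE sn) /= -hy in sxs.
have sxy : sorted adj (x :: y).
  by case: y yn sxs sy {ey hy mer} => //= z y _ -> ->.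
(* A new point in front lengthens the run leading to the first old piece. *)
case Px: (P x); last first.
  exists Q, Qs, (x :: y), L; split => //.
  - by rewrite /= Px.
  - exists (x :: a), b; split => //; rewrite ?ey //=.
    by rewrite (nP x) ?Px.
  (* The prefix [u] makes the merging statement inductive: [x] moves into the part already read. *)
  - move=> u Y Z YZ; have := mer (rcons u x) _ _ YZ.
    by rewrite !cat_rcons.
case Ps: (head_in P s).
  have a0 : a = [::] by apply/eqP; rewrite ea Ps.
  exists (x :: Q), Qs, (x :: y), L; split => //.
  - by case: (s) Ps eP => // z s0 Pz eP; apply: pieces_cons1.
  - exists [::], b; split => //; rewrite ?ey ?a0 //=; first by have /andP[] := ab.
    by move=> /be; case: (Q) Qn.
  - move=> u Y Z YZ; have := mer (rcons u x) _ _ YZ.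
    by rewrite !cat_rcons.
(* In the remaining case an old piece ends in [x] and the walk comes back through the new run
   [r :: a]. *)
rewrite Ps in ea; case: a ea ey ab => // r a _ ey /andP[/= /andP[rc ac] bc].
have a0 : a != [::].
  apply/eqP => a0; rewrite {}a0 in ey.
  have Qx : head pt0 Q \in Q by case: (Q) Qn => //= *; rewrite mem_head.
  have : head pt0 Q = x.
    move: sxs; rewrite ey /= => xr.
    have rQ : adj r (head pt0 Q) by move: sy; rewrite ey; case: (Q) Qn => //= ? ? _ /andP[].
    have rc' : r.1 = m.+2 by apply/eqP.
    have e1 := adj_right rQ rc' (allP QP _ Qx).
    rewrite adjC in xr; have e2 := adj_right xr rc' Px.
    exact: right_of_inj (etrans (esym e1) e2).
  move=> eQ; have : x \in s.
    have : x \in flatten (pieces P s) by rewrite eP /= mem_cat -eQ Qx.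
    by rewrite flatten_pieces mem_filter => /andP[].
  by move=> xs; move: us; rewrite /= xs.
exists [:: x], (Q :: Qs), [:: x; r], ((a ++ Q ++ b) :: L); split => //.
- by rewrite Px Ps eP.
- exists [::], [:: r]; split => //=.
  + by rewrite rc.
  + by rewrite andbT; move: sxs; rewrite ey.
- split => //; exists a, b; split => //; first by rewrite ac.
    by move: sy; rewrite ey /= => /path_sorted.
  exact: negbTE.
- move=> u Y Z YZ.
  have cf z : in_col m.+2 z -> from m z by rewrite -addn2; exact: in_col_from.
  have eu : (u ++ [:: x; r]) ++ a ++ Q ++ b = rcons u x ++ y.
    by rewrite cat_rcons ey -catA.
  change (view m ((a ++ Q ++ b) :: L) ++ Y) with
     (view_path m (a ++ Q ++ b) :: view m L ++ Y).
  apply: merges_join.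
  + by rewrite rev_cat /= cf.
  + by case: (a) a0 ac => //= z a' _ /andP[/cf].
  + rewrite last_cat /=; move: sy; rewrite ey.
    by case: (a) a0 => //= z a' _ /andP[].
  + by rewrite eu -cat_rcons; apply: mer.
Qed.

(** * Configurations *)

Lemma sorted_catE (T : eqType) (e : rel T) x0 s t : sorted e (s ++ t) =
  [&& sorted e s, sorted e t & (s == [::]) || (t == [::]) || e (last x0 s) (head x0 t)].
Proof.
case: s t => [|x s] [|y t] //=; rewrite ?cats0 ?andbT //.
by rewrite cat_path /=; case: (path _ x s); rewrite //= andbC.
Qed.

(** Between [p] and [q] the walk makes an excursion to the right of column [c], so [p] ends and [q]
    starts in that column. The bound on the size reflects that a walk cannot leave a single point
    the way it came; in frames it becomes the rule that only the last segment may be a single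
    point. *)
Definition link (c : nat) (p q : seq point) :=
  [&& (last pt0 p).1 == c, (head pt0 q).1 == c & 1 < size p].

(* The part of a walk lying in columns [0, ..., j], cut into its maximal
   pieces. *)
Record config (h j : nat) (C : seq (seq point)) : Prop := Config {
  config_path : all is_path C;
  config_uniq : uniq (flatten C);
  config_grid : all (in_grid j.+1 h) (flatten C);
  config_col : forall c, c <= j -> c \in map fst (flatten C);
  config_head : head pt0 (flatten C) = (0, h.-1);
  config_link : sorted (link j) C;
  config_trap : let e := last pt0 (flatten C) in
    (e.1 < j) || (size (last [::] C) == 1) ->
    trapped (in_grid j.+1 h) (flatten C) e
}.

Section Config.
Variables (h j : nat) (C : seq (seq point)).
Hypothesis HC : config h j C.

Lemma config_nonempty : all (fun p => p != [::]) C.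
Proof. by apply: sub_all (config_path HC) => p /andP[]. Qed.

Lemma config_neq0 : C != [::].
Proof. by have := config_col HC (leq0n j); case: C. Qed.

Lemma config_nth_link i : i.+1 < size C -> link j (nth [::] C i) (nth [::] C i.+1).
Proof. by move=> iC; apply: (sortedP [::] (config_link HC)). Qed.

Lemma config_start i : 0 < i < size C -> (head pt0 (nth [::] C i)).1 = j.
Proof. by case: i => // i /config_nth_link /and3P[_ /eqP]. Qed.

Lemma config_end i : i.+1 < size C -> (last pt0 (nth [::] C i)).1 = j.
Proof. by move=> /config_nth_link /and3P[/eqP]. Qed.

Lemma config_size i : i.+1 < size C -> 1 < size (nth [::] C i).
Proof. by move=> /config_nth_link /and3P[]. Qed.

Lemma config_last : last pt0 (flatten C) = last pt0 (last [::] C).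
Proof. exact: last_flatten config_nonempty. Qed.

Lemma config_upto : all (upto j) (flatten C).
Proof. by apply: sub_all (config_grid HC) => v /andP[]. Qed.

Lemma config_mem p : p \in C -> [/\ p != [::], sorted adj p, uniq p & all (upto j) p].
Proof.
move=> pC; have /andP[p0 sp] := allP (config_path HC) p pC.
split => //.
  move: (config_uniq HC); case/splitPr: pC => C1 C2.
  by rewrite flatten_cat /= catA !cat_uniq => /andP[/and3P[_ _ ->]].
by apply/allP => v vp; apply: (allP config_upto); apply/flattenP; exists p.
Qed.

Lemma config_mem_link p : p \in C -> [\/ head pt0 p = (0, h.-1) | (head pt0 p).1 = j] /\
   [\/ last pt0 p = last pt0 (flatten C) | (last pt0 p).1 = j].
Proof.
move=> /(nthP [::])[i iC <-]; split.
  case: i iC => [|i] iC; last by right; apply: config_start.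
  by left; rewrite nth0 -head_flatten ?config_nonempty ?(config_head HC).
case: (ltnP i.+1 (size C)) => iC'; last first.
  left; have e : size C = i.+1 by apply/eqP; rewrite eqn_leq; apply/andP.
  by rewrite config_last -(nth_last [::]) e.
by right; apply: config_end.
Qed.

(** The points are distinct, so the end of the walk occurs in no piece but the last. This shows that
    a segment whose end is not extended is the last one. *)
Lemma config_last_inj i : i < size C ->
  last pt0 (nth [::] C i) = last pt0 (flatten C) -> i.+1 = size C.
Proof.
move=> iC; apply: contra_eq => ineq.
have iC' : i.+1 < size C by rewrite ltn_neqAle ineq.
have lastin p : p != [::] -> last pt0 p \in p by case: p => //= ? ?; rewrite mem_last.
have [x0 nx0] : exists p, p \in drop i.+1 C.
  by exists (nth [::] (drop i.+1 C) 0); apply: mem_nth; rewrite size_drop subn_gt0.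
have eC : flatten C = flatten (take i.+1 C) ++ flatten (drop i.+1 C).
  by rewrite -flatten_cat cat_take_drop.
have dn : flatten (drop i.+1 C) != [::].
  have := allP config_nonempty x0 (mem_drop nx0).
  apply: contra => /eqP d0; case: x0 nx0 => // v p vp.
  have : v \in flatten (drop i.+1 C) by apply/flattenP; exists (v :: p); rewrite ?mem_head.
  by rewrite d0.
apply/eqP => ee; have := config_uniq HC; rewrite eC cat_uniq => /and3P[_ /hasP[]].
exists (last pt0 (nth [::] C i)); last first.
  apply/flattenP; exists (nth [::] C i); last first.
    by apply/lastin/(allP config_nonempty)/mem_nth.
  by rewrite -(nth_take _ (ltnSn i)) mem_nth // size_take iC'.
by rewrite ee eC last_cat; case: (flatten _) dn => //= ? ?; rewrite mem_last.
Qed.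

(** A piece with a successor ends in column [j], one with a predecessor starts there, and a sole
    piece meets every column; hence no segment of a view is empty. *)
Lemma config_has m : m <= j -> all (has (from m)) C.
Proof.
move=> mj; apply/allP => p pC; have [p0 _ _ _] := config_mem pC.
have jm v : v.1 = j -> from m v by rewrite /from => ->.
move: pC => /(nthP [::])[i iC ep].
case: (ltnP i.+1 (size C)) => iC'.
  apply/hasP; exists (last pt0 p); first by case: (p) p0 => //= ? ?; rewrite mem_last.
  by apply: jm; rewrite -ep; apply: config_end.
case: i ep iC iC' => [|i] ep iC iC'.
  have eC : C = [:: p] by case: (C) ep iC iC' => // q [] //= ->.
  have /mapP[v] := config_col HC (leqnn j); rewrite eC /= cats0 => vp ej.
  by apply/hasP; exists v => //; apply: jm.
apply/hasP; exists (head pt0 p); first by case: (p) p0 => //= *; rewrite mem_head.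
by apply: jm; rewrite -ep; apply: config_start.
Qed.

Lemma view_is_frame m w : m + w = j.+1 -> 0 < w -> is_frame w h (view m C).
Proof.
move=> mw w0; have mj : m <= j by lia.
apply/and4P; split.
- rewrite /view all_map; apply/allP => p pC /=; rewrite /is_segment.
  have [p0 sp _ _] := config_mem pC.
  rewrite /view_path -size_eq0 size_map size_eq0 pieces_eq0 negbK (allP (config_has mj)) //=.
  rewrite all_map; apply/allP => q qp /=; have [q0 qm] := mem_pieces qp.
  rewrite /is_path sorted_adj_shift // -size_eq0 size_map size_eq0 q0 /=.
  exact: (allP (sorted_pieces (from m) sp) q qp).
- rewrite points_view map_inj_in_uniq ?filter_uniq ?(config_uniq HC) //.
  by move=> v v'; rewrite !mem_filter => /andP[mv _] /andP[mv' _]; apply: shift_inj.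
- rewrite points_view all_map; apply/allP => v; rewrite mem_filter => /andP[mv].
  by move=> /(allP (config_grid HC)); move: mv; rewrite /from /in_grid /=; lia.
- apply/allP => c; rewrite mem_iota add0n points_view => cw.
  have /mapP[v vC ev] := config_col HC (c := m + c) ltac:(lia).
  apply/mapP; exists (shift m v); last by rewrite /= -ev addKn.
  by apply: map_f; rewrite mem_filter vC /from -ev leq_addr.
Qed.

End Config.

Lemma view_extendable h m C : config h m.+1 C -> extendable (view m C).
Proof.
move=> HC; rewrite /extendable size_map.
have inm p : p \in C -> head pt0 p \in p /\ last pt0 p \in p.
  move=> /(config_mem HC)[]; case: p => //= *; by rewrite mem_head mem_last.
split=> i iC.
  have iC' : i < size C by case/andP: iC.
  rewrite /nth_seg (nth_map [::]) // seg_start_in /=.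
    by rewrite (config_start HC) // subSnn.
  have [p0 _ _ _] := config_mem HC (mem_nth [::] iC').
  by rewrite (head_inE _ pt0) // /from (config_start HC).
have iC' : i < size C by apply: ltnW.
have [p0 _ _ _] := config_mem HC (mem_nth [::] iC').
rewrite /nth_seg (nth_map [::]) // seg_end_in /=.
  by rewrite (config_end HC) // subSnn.
by rewrite (head_in_rev _ pt0) // /from (config_end HC).
Qed.

Lemma extends_path_seg m e first (last_ : bool) Q y :
    extends_path m.+2 e first Q y -> Q != [::] -> all (upto m.+1) Q ->
    (last pt0 Q = e -> last_) ->
  extends_seg first last_ (view_path m Q) (view_path m y).
Proof.
move=> [a [b [ey /andP[ac bc] sy ea be]]] Q0 Qm Qe.
have cf v : in_col m.+2 v -> from m v by rewrite -addn2; apply: in_col_from.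
have cfa s : all (in_col m.+2) s -> all (from m) s by apply: sub_all.
have hQ : head pt0 Q \in Q by case: (Q) Q0 => //= *; rewrite mem_head.
have lQ : last pt0 Q \in Q by case: (Q) Q0 => //= *; rewrite mem_last.
move: sy; rewrite {}ey; rewrite !(sorted_catE _ pt0) => /and3P[sa /and3P[sQ sb Qb] aQ].
have {}aQ : a != [::] -> last pt0 a = right_of (head pt0 Q).
  move=> a0; rewrite (negbTE a0) in aQ.
  apply: (@adj_right _ _ m.+1); last exact: (allP Qm).
    by move: aQ; case: (Q) Q0.
  by apply/eqP/(allP ac); case: (a) a0 => //= *; rewrite mem_last.
have {}Qb : b != [::] -> head pt0 b = right_of (last pt0 Q).
  move=> b0; rewrite (negbTE Q0) (negbTE b0) /= adjC in Qb.
  apply: (@adj_right _ _ m.+1) => //; last exact: (allP Qm).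
  by apply/eqP/(allP bc); case: (b) b0 => //= *; rewrite mem_head.
have r_from v v' : v = right_of v' -> in_col m.+2 v -> from m v'.
  by move=> ->; rewrite /in_col /from /right_of /=; clear; lia.
have aQm : a != [::] -> head_in (from m) Q.
  move=> a0; rewrite (head_inE _ pt0) //; apply: r_from (aQ a0) _.
  by apply: (allP ac); case: (a) a0 => //= *; rewrite mem_last.
have Qbm : b != [::] -> from m (last pt0 Q).
  move=> b0; apply: r_from (Qb b0) _.
  by apply: (allP bc); case: (b) b0 => //= *; rewrite mem_head.
have rsh v : from m v -> shift m (right_of v) = right_of (shift m v).
  by rewrite /from /shift /right_of /= => mv; rewrite subSn.
have run s : sorted adj s -> all (in_col m.+2) s -> new_run (map (shift m) s).
  move=> ss sc; rewrite /new_run sorted_adj_shift ?cfa // ss /= all_map.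
  by apply: sub_all sc => v /=; rewrite /in_col => /eqP ->; rewrite -addn2 addKn.
exists (map (shift m) a), (map (shift m) b); split.
- rewrite catA view_path_append ?view_path_prepend ?cfa // => b0.
  by rewrite rev_cat; have := Qbm b0; rewrite -(head_in_rev _ pt0) //; case: (rev Q).
- by rewrite !run.
- rewrite -ea; case: eqP => a0; first by rewrite a0.
  move/eqP: a0 => a0; rewrite -size_eq0 size_map size_eq0; split => //.
  rewrite seg_start_in ?aQm // -rsh; last by have := aQm a0; rewrite (head_inE _ pt0).
  by rewrite -aQ // -[pt0 in LHS]/(shift m pt0) last_map.
- case: (eqVneq b [::]) => b0; [left; split; first by rewrite b0|right].
    exact/Qe/be.
  rewrite -size_eq0 size_map size_eq0; split => //.
  rewrite seg_end_in ?(head_in_rev _ pt0) ?Qbm // -rsh ?Qbm // -Qb //.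
  by case: (b) b0.
Qed.

(** * Extensions of frames from configurations *)

(** Meant for the pieces after the first one, which start in the new column, whence the flag
    [false]. Pieces without old points are filtered out: they are the segments inserted
    afterwards. *)
Lemma extend_paths m e Cs :
    (forall p, p \in Cs -> [/\ sorted adj p, uniq p, all (upto m.+2) p,
       ~~ head_in (upto m.+1) p & upto m.+1 (last pt0 p) -> last pt0 p = e]) ->
  exists2 Ys, all2p (extends_path m.+2 e false) (clip m.+1 Cs) Ys
    & merges (view m Ys) (view m (filter (has (upto m.+1)) Cs)).
Proof.
elim: Cs => [|p Cs IHCs] HCs; first by exists [::] => //; constructor.
have [Ys RYs mYs] : exists2 Ys, all2p (extends_path m.+2 e false) (clip m.+1 Cs) Ys
    & merges (view m Ys) (view m (filter (has (upto m.+1)) Cs)).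
  by apply: IHCs => q qC; apply: HCs; rewrite inE qC orbT.
have [sp up mp hp lp] := HCs p (mem_head _ _).
case hP: (has (upto m.+1) p); last first.
  by exists Ys; rewrite /clip /= ?hP // pieces_none ?hP.
have [Q [Qs [y [L [eQ Qy QL _ mer]]]]] := extend_path sp up mp hP.
have weak f Q' y' : Q' \in Q :: Qs -> extends_path m.+2 (last pt0 p) f Q' y' ->
    extends_path m.+2 e f Q' y'.
  rewrite -eQ => /mem_pieces[Q0 QP] [a [b [ey ab sy ea be]]].
  exists a, b; split => // /be el; rewrite el; apply: lp; rewrite -el.
  by apply: (allP QP); case: (Q') Q0 => //= *; rewrite mem_last.
exists (y :: L ++ Ys); rewrite /clip /=.
  rewrite eQ /=; split; first by apply: weak; rewrite ?mem_head // -(negbTE hp).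
  apply: all2p_cat RYs; apply: all2p_impl QL => Q' y' Qin; apply: weak.
  by rewrite inE Qin orbT.
rewrite hP /=; have := mer [::] _ _ mYs; rewrite /= /view map_cat.
by [].
Qed.

Lemma extends_segs_view h m C C' :
    config h m.+1 C -> config h m.+2 C' -> C = clip m.+1 C' ->
  exists2 Ys, extends_segs (view m C) (view m Ys)
    & merges (view m Ys) (view m (filter (has (upto m.+1)) C')).
Proof.
move=> HC HC' eC; set P := upto m.+1; set e := last pt0 (flatten C).
(* A piece that ends in an old column ends the walk, and this end is then also the last point of
   [C]. *)
have Pe p : p \in C' -> P (last pt0 p) -> last pt0 p = e.
  move=> pC Plp; have [_ [ep|lp]] := config_mem_link HC' pC; last first.
    by move: Plp; rewrite /P /upto lp ltnn.
  rewrite /e eC flatten_clip last_filter_in // (head_in_rev _ pt0) -?ep //.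
  have [p0 _ _ _] := config_mem HC' pC; apply: contra p0 => /eqP f0.
  have : all (fun v => v \in flatten C') p.
    by apply/allP => v vp; apply/flattenP; exists p.
  by rewrite f0; case: (p).
(* Only the first piece starts at an old point, so it is treated apart, with the flag [true]. *)
case eC' : C' (config_neq0 HC') => [//|p0 Cr] _.
have p0C : p0 \in C' by rewrite eC' mem_head.
have [p00 sp0 up0 mp0] := config_mem HC' p0C.
have hp0 : head_in P p0.
  rewrite (head_inE _ pt0) //; have := config_head HC'.
  by rewrite head_flatten ?(config_nonempty HC') // eC' /= => ->.
have hasp0 : has P p0 by case: (p0) hp0 => //= ? ? ->.
have [Q [Qs [y [L [eQ Qy QL _ mer]]]]] := extend_path sp0 up0 mp0 hasp0.
have [Ys RYs mYs] : exists2 Ys, all2p (extends_path m.+2 e false) (clip m.+1 Cr) Ys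
    & merges (view m Ys) (view m (filter (has (upto m.+1)) Cr)).
  apply: extend_paths => p pCr.
  have pC : p \in C' by rewrite eC' inE pCr orbT.
  have [pn sp up mp] := config_mem HC' pC; split => //; last exact: Pe.
  rewrite (head_inE _ pt0) // /upto.
  have [i iC ep] := nthP [::] pCr.
  have := @config_start _ _ _ HC' i.+1; rewrite eC' /= ltnS iC => /(_ isT).
  by rewrite ep => ->; rewrite ltnn.
have weak f Q' y' : Q' \in Q :: Qs -> extends_path m.+2 (last pt0 p0) f Q' y' ->
    extends_path m.+2 e f Q' y'.
  rewrite -eQ => /mem_pieces[Q0 QP] [a [b [ey ab sy ea be]]].
  exists a, b; split => // /be el; rewrite el; apply: Pe; rewrite // -el.
  by apply: (allP QP); case: (Q') Q0 => //= *; rewrite mem_last.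
have eCQ : C = Q :: (Qs ++ clip m.+1 Cr) by rewrite eC eC' /clip /= eQ.
have R0 : extends_path m.+2 e true Q y.
  by apply: weak; rewrite ?mem_head // -[true]hp0.
have RR : all2p (extends_path m.+2 e false) (Qs ++ clip m.+1 Cr) (L ++ Ys).
  apply: all2p_cat RYs; apply: all2p_impl QL => Q' y' Qin; apply: weak.
  by rewrite inE Qin orbT.
exists (y :: L ++ Ys); last first.
  rewrite /= hasp0; have := mer [::] _ _ mYs; rewrite /= /view map_cat.
  by [].
split; first by rewrite !size_map eCQ /= (all2p_size RR).
move=> i; rewrite size_map => iC.
have H : extends_path m.+2 e (i == 0) (nth [::] C i) (nth [::] (y :: L ++ Ys) i).
  rewrite eCQ in iC *; case: i iC => // i iC.
  exact: (all2p_nth [::] [::] RR iC).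
have iY : i < size (y :: L ++ Ys) by move: iC; rewrite eCQ /= (all2p_size RR).
rewrite /nth_seg !(nth_map [::]) //.
have [Q0 _ _ Qm] := config_mem HC (mem_nth [::] iC).
apply: extends_path_seg H Q0 Qm _ => /(config_last_inj HC iC) /eqP.
by [].
Qed.

Lemma extension_view h m C C' :
    config h m.+1 C -> config h m.+2 C' -> C = clip m.+1 C' ->
  extension h (view m C) (view m C').
Proof.
move=> HC HC' eC; split; first exact: view_extendable HC.
  by apply: (view_is_frame HC'); rewrite ?addn3.
have [Ys ext mer] := extends_segs_view HC HC' eC.
exists (view m Ys), (view m (filter (has (upto m.+1)) C')); split => //.
have nthm i : i < size C' -> ~~ nth true (map (has (upto m.+1)) C') i ->
    all (in_col m.+2) (nth [::] C' i).
  move=> iC; rewrite (nth_map [::]) // => hi; apply/allP => v vp.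
  have [_ _ _ /allP/(_ v vp)] := config_mem HC' (mem_nth [::] iC).
  have : ~~ upto m.+1 v by apply: contra hi => Pv; apply/hasP; exists v.
  by rewrite /upto /in_col; lia.
exists (map (has (upto m.+1)) C'); split.
- by rewrite !size_map.
- by rewrite /view -map_mask filter_mask.
- case eC' : C' (config_neq0 HC') => [//|p0 Cr] _ /=.
  have p0C : p0 \in C' by rewrite eC' mem_head.
  have [p00 _ _ _] := config_mem HC' p0C.
  have := config_head HC'; rewrite head_flatten ?(config_nonempty HC') // eC' /=.
  by case: (p0) p00 => //= v p _ ->.
- move=> i; rewrite size_map => iC /(nthm i iC) coli.
  have [p0 sp _ _] := config_mem HC' (mem_nth [::] iC).
  have fi : all (from m) (nth [::] C' i).
    by apply: sub_all coli => v; rewrite -addn2; apply: in_col_from.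
  exists (map (shift m) (nth [::] C' i)); split.
  + by rewrite /nth_seg (nth_map [::]) // /view_path pieces_all.
  + by rewrite -size_eq0 size_map size_eq0.
  + rewrite /new_run sorted_adj_shift // sp all_map /=.
    by apply: sub_all coli => v; rewrite /in_col /= => /eqP ->; rewrite -addn2 addKn.
  + rewrite !size_map /view ?size_map; case: eqP => //= /eqP ineq.
    by apply: (config_size HC'); rewrite ltn_neqAle ineq.
(* If the last piece is new, the last old one has a successor in [C'] and therefore ends in the new
   column. *)
- move=> lastN; set Z := filter _ C'.
  have Zn : Z != [::].
    have Cn := config_neq0 HC; rewrite -has_filter; apply/hasP.
    have [p pC] : exists p, p \in C by case: (C) Cn => // p ? _; exists p; rewrite mem_head.
    move: pC; rewrite eC => /flatten_mapP[p' p'C pp']; exists p' => //.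
    by rewrite -[has _ _]negbK -pieces_eq0; apply/eqP => e0; rewrite e0 in pp'.
  have : last [::] Z \in Z by case: (Z) Zn => //= *; rewrite mem_last.
  rewrite mem_filter => /andP[hZ /(nthP [::])[i iC ei]].
  have [p0 sp _ _] := config_mem HC' (mem_nth [::] iC).
  have iC' : i.+1 < size C'.
    rewrite ltn_neqAle iC andbT; apply: contraNneq lastN => eis.
    rewrite -nth_last size_map -eis /= (nth_map [::]) ?ei //.
  have le := config_end HC' iC'.
  rewrite /last_seg /view -[X in last X]/(view_path m [::]) last_map -/Z -ei.
  rewrite seg_end_in /= ?le ?subSS; first by rewrite -addn2 addKn.
  by rewrite (head_in_rev _ pt0) // /from le; lia.
Qed.

(** The trapping tests of frame and configuration agree as soon as no neighbour of [q] is hidden to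
    the left of the window. *)
Lemma trapped_view w h m C q : (forall r, adj q r -> from m r) -> from m q ->
  trapped (in_grid w h) (points (view m C)) (shift m q) <->
  trapped (in_grid (m + w) h) (flatten C) q.
Proof.
move=> qm mq; split=> tr r rg qr.
  have := tr (shift m r); rewrite adj_shift ?(qm r qr) // => /(_ _ qr).
  rewrite points_view => H.
  have /mapP[r'] : shift m r \in [seq shift m v | v <- flatten C & from m v].
    by apply: H; move: rg (qm r qr); rewrite /in_grid /from /=; lia.
  by rewrite mem_filter => /andP[mr' r'C] /(shift_inj (qm r qr) mr') ->.
have er : r = shift m (r.1 + m, r.2) by rewrite /shift /= addnK; case: (r).
have mr : from m (r.1 + m, r.2) by rewrite /from leq_addl.
rewrite points_view er; apply: map_f; rewrite mem_filter mr /=.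
apply: tr; last by rewrite -(adj_shift mq mr) -er.
by move: rg; rewrite /in_grid /=; lia.
Qed.

(** By [last_window], an end right of the left column of the window cannot be a point where the walk
    left the window. The second conclusion prepares [trapped_view]. *)
Lemma config_view_end h m j C q : config h j C -> m < j ->
    seg_end (last_seg (view m C)) = shift m q -> m < q.1 ->
  last pt0 (flatten C) = q /\ (forall r, adj q r -> from m r).
Proof.
move=> HC mj; rewrite /last_seg /view -[X in last X]/(view_path m [::]) last_map.
rewrite seg_end_view_path => eq mq.
have lC : last [::] C \in C by case: (C) (config_neq0 HC) => //= *; rewrite mem_last.
have [p0 sp _ _] := config_mem HC lC.
have : last pt0 (filter (from m) (last [::] C)) \in filter (from m) (last [::] C).
  have := allP (config_has HC (ltnW mj)) _ lC; rewrite has_filter.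
  by case: (filter _ _) => //= *; rewrite mem_last.
rewrite mem_filter => /andP[ml _].
have e := shift_inj ml (ltnW mq) eq.
split; first by rewrite (config_last HC) -e; apply: last_window; rewrite // e.
by move=> r; move: mq; rewrite /from /adj /distn1; lia.
Qed.

(** The predecessor of a point strictly right of the left column is visible as well, so a segment
    reduced to such a point is a whole piece. *)
Lemma last_single_window m p : sorted adj p -> m < (last pt0 p).1 -> p != [::] ->
  size (filter (from m) p) = 1 -> size p = 1.
Proof.
case/lastP: p => // p q; case/lastP: p => // p y; rewrite last_rcons => sp mq _.
rewrite !filter_rcons.
have ayq : adj y q by case: p sp => [|z p] /=; rewrite ?rcons_path ?last_rcons => /andP[].
have -> : from m y by move: mq ayq; rewrite /from /adj /distn1; lia.
by rewrite /from ltnW // !size_rcons.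
Qed.

Lemma view_not_removed h m C : config h m.+2 C -> ~ removed h (view m C).
Proof.
move=> HC [ntr H]; apply: ntr; rewrite /frame_trapped.
have [q eq mq] : exists2 q, seg_end (last_seg (view m C)) = shift m q & from m q.
  exists ((seg_end (last_seg (view m C))).1 + m, (seg_end (last_seg (view m C))).2).
    by rewrite /shift /= addnK -surjective_pairing.
  by rewrite /from leq_addl.
have mq' : m < q.1.
  by case: H; [|case=> _]; rewrite eq /=; lia.
have [eq' qr] := config_view_end HC (leqnSn _) eq mq'.
rewrite eq; apply/trapped_view => //; rewrite addn3 -eq'; apply: (config_trap HC) => /=.
rewrite eq'; case: H => [|[sing]]; rewrite eq /= => q1; first by rewrite (_ : q.1 < m.+2) //; lia.
apply/orP; right; move: sing; rewrite /single_point /last_seg /view.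
rewrite -[X in last X]/(view_path m [::]) last_map flatten_view_path size_map => /eqP s1.
have lC : last [::] C \in C by case: (C) (config_neq0 HC) => //= *; rewrite mem_last.
have [p0 sp _ _] := config_mem HC lC.
by apply/eqP/(last_single_window sp _ p0 s1); rewrite -(config_last HC) eq'.
Qed.

(** * Lifting extensions of frames *)

Lemma subn1_gt a b : a - b = 1 -> b < a.
Proof. by lia. Qed.

Definition unshift (m : nat) (v : point) : point := (v.1 + m, v.2).

Lemma unshiftK m : cancel (unshift m) (shift m).
Proof. by case=> a b; rewrite /shift /= addnK. Qed.

Lemma map_unshiftK m s : map (shift m) (map (unshift m) s) = s.
Proof. by rewrite -map_comp map_id_in // => v _ /=; rewrite unshiftK. Qed.

Lemma from_unshift m s : all (from m) (map (unshift m) s).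
Proof. by rewrite all_map; apply/allP => v _; rewrite /from /= leq_addl. Qed.

Lemma new_run_unshift m s : new_run s ->
  sorted adj (map (unshift m) s) && all (in_col m.+2) (map (unshift m) s).
Proof.
case/andP=> ss sc; rewrite -(@sorted_adj_shift m) ?from_unshift // map_unshiftK ss.
by rewrite all_map; apply: sub_all sc => v /= /eqP; rewrite /in_col /= => ->.
Qed.

Lemma last_in (T : eqType) (x : T) s : s != [::] -> last x s \in s.
Proof. by case: s => //= *; rewrite mem_last. Qed.

Lemma head_mem (T : eqType) (x : T) s : s != [::] -> head x s \in s.
Proof. by case: s => //= *; rewrite mem_head. Qed.

Lemma in_col_out m v : in_col m.+2 v -> ~~ upto m.+1 v.
Proof. by rewrite /in_col /upto; lia. Qed.

Lemma pieces_out m s : all (in_col m.+2) s -> pieces (upto m.+1) s = [::].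
Proof.
move=> sc; apply: pieces_none; rewrite -all_predC; apply: sub_all sc => v.
exact: in_col_out.
Qed.

Lemma adj_right_of v : adj (right_of v) v.
Proof. by rewrite /adj /distn1 /=; lia. Qed.

Lemma lift_segment h m C i V : config h m.+1 C -> i < size C ->
    extends_seg (i == 0) (i.+1 == size C) (view_path m (nth [::] C i)) V ->
  exists y, [/\ view_path m y = V, pieces (upto m.+1) y = [:: nth [::] C i],
    sorted adj y,
    (if i == 0 then head pt0 y = (0, h.-1) else in_col m.+2 (head pt0 y))
    & i.+1 < size C -> in_col m.+2 (last pt0 y)].
Proof.
move=> HC iC [a [b [eV /andP[ra rb] ea eb]]].
set Q := nth [::] C i in eV ea eb *.
have QC : Q \in C by apply: mem_nth.
have [Q0 sQ _ QP] := config_mem HC QC.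
have /andP[sa ca] := new_run_unshift m ra.
have /andP[sb cb] := new_run_unshift m rb.
set a' := map (unshift m) a in sa ca *; set b' := map (unshift m) b in sb cb *.
have a0 : (a' == [::]) = (a == [::]) by rewrite -!size_eq0 size_map.
have b0 : (b' == [::]) = (b == [::]) by rewrite -!size_eq0 size_map.
have aQ : a != [::] -> [/\ i != 0, from m (head pt0 Q) & last pt0 a' = right_of (head pt0 Q)].
  move=> an; move: ea; case: eqP => [_ a_|/eqP i0 [_]]; first by rewrite a_ in an.
  have hQ : from m (head pt0 Q) by rewrite /from (config_start HC) ?lt0n ?i0.
  rewrite seg_start_in ?(head_inE _ pt0) // => la; split => //.
  rewrite /a' (last_nth pt0).
  have -> : nth pt0 (pt0 :: map (unshift m) a) (size (map (unshift m) a)) =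
            unshift m (last pt0 a).
    by case: (a) an => //= v a1 _; rewrite -last_nth last_map.
  by rewrite la /unshift /right_of /= addSn subnK.
have Qb : b != [::] -> from m (last pt0 Q) /\ head pt0 b' = right_of (last pt0 Q).
  move=> bn; case: eb => [[b_ _]|[_ hb]]; first by rewrite b_ in bn.
  (* The run [b] starts in frame column 2, so the segment ends in column 1; this is not the leftmost
     column, hence it is the end of [Q] itself. *)
  have s1 : (seg_end (view_path m Q)).1 = 1.
    have /eqP : (head pt0 b).1 == 2 by case/andP: rb => _ /allP; apply; apply: head_mem.
    by rewrite hb /= => -[].
  have lQ : last pt0 Q = last pt0 (filter (from m) Q).
    by apply: last_window => //; apply: subn1_gt; rewrite seg_end_view_path in s1.
  have mQ : from m (last pt0 Q).
    by apply/ltnW/subn1_gt; rewrite seg_end_view_path -lQ in s1.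
  split=> //; have -> : head pt0 b' = unshift m (head pt0 b) by rewrite /b'; case: (b) bn.
  rewrite hb seg_end_view_path -lQ /unshift /right_of /= addSn subnK //.
exists (a' ++ Q ++ b'); split.
- rewrite eV catA view_path_append ?view_path_prepend ?from_unshift ?map_unshiftK //.
    by rewrite a0 => /aQ[_ + _]; rewrite -(head_inE _ pt0).
  rewrite b0 => /Qb[+ _]; rewrite -(head_in_rev _ pt0) // rev_cat.
  by case: (rev Q).
- rewrite pieces_cat_sep; last first.
    rewrite negb_and; case: (eqVneq a' [::]) => [->//|an].
    by rewrite (head_in_rev _ pt0) // in_col_out // (allP ca) ?last_in.
  rewrite pieces_cat_sep ?(pieces_out ca) ?(pieces_out cb) ?cats0 /= ?pieces_all //.
  rewrite negb_and orbC; case: (eqVneq b' [::]) => [->//|bn].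
  by rewrite (head_inE _ pt0) // in_col_out // (allP cb) ?head_mem.
- rewrite !(sorted_catE _ pt0) sa sQ sb /= a0 b0 (negbTE Q0) /=.
  apply/andP; split.
    by case: eqP => //= /eqP/Qb[_ ->]; rewrite adjC adj_right_of.
  have -> : (Q ++ b' == [::]) = false by case: (Q) Q0.
  rewrite /=; case: eqP => //= /eqP/aQ[_ _ ->].
  by case: (Q) Q0 => //= *; apply: adj_right_of.
- case: eqP ea => [i0 a_|/eqP i0 [an _]].
    have -> : a' = [::] by apply/eqP; rewrite a0 a_.
    rewrite /= -(config_head HC) head_flatten ?(config_nonempty HC) //.
    have -> : head [::] C = Q by rewrite /Q i0 nth0.
    by case: (Q) Q0.
  rewrite -a0 in an; have -> : head pt0 (a' ++ Q ++ b') = head pt0 a' by case: (a') an.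
  by rewrite (allP ca) ?head_mem.
- move=> iC'; case: eb => [[_]|[bn _]].
    by rewrite (ltn_eqF iC').
  rewrite -b0 in bn; have -> : last pt0 (a' ++ Q ++ b') = last pt0 b'.
    by rewrite !last_cat; case: (b') bn.
  by rewrite (allP cb) ?last_in.
Qed.

Lemma choose_seq (T : Type) (x0 : T) n (R : nat -> T -> Prop) :
  (forall i, i < n -> exists x, R i x) ->
  exists2 s, size s = n & forall i, i < n -> R i (nth x0 s i).
Proof.
elim: n R => [|n IHn] R HR; first by exists [::].
have [x Rx] := HR 0 isT.
have [s sn Rs] := IHn (fun i => R i.+1) (fun i lt => HR i.+1 lt).
by exists (x :: s); rewrite /= ?sn // => -[|i] // /Rs.
Qed.

(** Invariant of the pieces while segments are extended and merged. The old point guarantees a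
    second vertex once the end lies in the new column, which is the size condition of [link]. *)
Definition old_path (m : nat) (p : seq point) := is_path p && has (upto m.+1) p.

Lemma old_path_size m p : old_path m p -> in_col m.+2 (last pt0 p) -> 1 < size p.
Proof.
case: p => [|v [|w p]] // /andP[_ /=]; rewrite orbF => vP /in_col_out.
by rewrite vP.
Qed.

(** Merging concatenates neighbouring pieces, so the sequence of all points is unchanged; the
    clipped configuration is unchanged too, because the join takes place between two points of the
    new column. *)
Lemma lift_merges m Yv Z : merges Yv Z -> forall CY, Yv = view m CY ->
    all (old_path m) CY -> sorted (link m.+2) CY ->
  exists CZ, [/\ view m CZ = Z, all (old_path m) CZ, sorted (link m.+2) CZ,
    clip m.+1 CZ = clip m.+1 CY & flatten CZ = flatten CY].
Proof.
elim=> {Yv Z} [|S Y Z mer IH|S p q T Y Z apq mer IH] CY.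
- by case: CY => // _ _ _; exists [::].
- case: CY => //= y CY [eS eY] /andP[oy oCY] lCY.
  have [CZ [eZ oCZ lCZ cCZ fCZ]] := IH CY eY oCY (path_sorted lCY).
  exists (y :: CZ); split => //=.
  + by rewrite eZ eS.
  + by rewrite oy.
  + case: CZ oCZ lCZ fCZ {eZ cCZ} => //= z CZ /andP[/andP[/andP[z0 _] _] _] lz fz.
    rewrite lz andbT; case: CY oCY lCY fz {eY IH} => [|y2 CY] /=; first by case: (z) z0.
    move=> /andP[/andP[/andP[y20 _] _] _] /andP[+ _] fz.
    suff -> : link m.+2 y y2 = link m.+2 y z by [].
    by congr [&& _, _.1 == _ & _]; case: (z) (y2) z0 y20 fz => [|? ?] [|? ?] //= _ _ [].
  + by rewrite /clip /= [X in _ ++ X]cCZ.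
  + by rewrite fCZ.
- case: CY => [|y1 [|y2 CY]] //= [e1 e2 eY] /and3P[o1 o2 oCY] /andP[l12 lCY].
  have [/andP[y10 s1] h1] := andP o1; have [/andP[y20 s2] h2] := andP o2.
  have /and3P[/eqP l1 /eqP l2 z1] := l12.
  have f1 : head_in (from m) (rev y1).
    by rewrite (head_in_rev _ pt0) // /from l1; exact: (leqW (leqnSn m)).
  have f2 : head_in (from m) y2 by rewrite (head_inE _ pt0) // /from l2; exact: (leqW (leqnSn m)).
  have a12 : adj (last pt0 y1) (head pt0 y2).
    rewrite -(@adj_shift m); last by rewrite -(head_inE _ pt0).
      rewrite -seg_end_in // -seg_start_in // -e1 -e2 /seg_start /seg_end.
      by rewrite last_rcons.
    by rewrite -(head_in_rev _ pt0).
  have ey : view_path m (y1 ++ y2) = S ++ (p ++ q) :: T by apply: view_path_join.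
  have [||| CZ [eZ oCZ lCZ cCZ fCZ]] := IH ((y1 ++ y2) :: CY).
  + by rewrite /= ey eY.
  + rewrite /= oCY andbT /old_path /is_path has_cat h1 (sorted_catE _ pt0) s1 s2 a12.
    by rewrite !orbT -size_eq0 size_cat addn_eq0 size_eq0 (negbTE y10).
  + case: (CY) lCY => //= y3 CY' /andP[/and3P[l3 h3 s3] ->]; rewrite andbT.
    apply/and3P; split => //; last by rewrite size_cat ltn_addl.
    by rewrite last_cat; case: (y2) y20 l3.
  exists CZ; split => //; last by rewrite fCZ /= catA.
  rewrite cCZ /clip /= catA pieces_cat_sep // (head_in_rev _ pt0) //.
  by rewrite /upto l1 ltnn.
Qed.

Lemma lift_mask m bm (X : raw_frame) CZ (R : nat -> seq point -> Prop) :
    size bm = size X -> mask bm X = view m CZ ->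
    (forall i, i < size X -> ~~ nth true bm i ->
       exists2 p, nth [::] X i = view_path m p & R i p) ->
  exists CX, [/\ view m CX = X, mask bm CX = CZ
    & forall i, i < size X -> ~~ nth true bm i -> R i (nth [::] CX i)].
Proof.
elim: X bm CZ R => [|S X IHX] [|b bm] // CZ R; first by case: CZ => // _ _ _; exists [::].
move=> [sz] eZ HR.
have HR' i : i < size X -> ~~ nth true bm i ->
  exists2 p, nth [::] X i = view_path m p & R i.+1 p by apply: (HR i.+1).
case: b eZ HR => /= [|eZ HR].
  case: CZ => //= z CZ [eS eZ] HR.
  have [CX [eX mX RX]] := IHX _ _ (fun i => R i.+1) sz eZ HR'.
  exists (z :: CX); rewrite /= eX eS mX; split => // -[|i] // iX; exact: RX.
have [CX [eX mX RX]] := IHX _ _ (fun i => R i.+1) sz eZ HR'.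
have [p eS Rp] := HR 0 isT isT.
exists (p :: CX); rewrite /= eX -eS mX; split => // -[|i] // iX; exact: RX.
Qed.

Lemma mem_mask_nth (T : eqType) (x0 : T) bm s i : size bm = size s -> i < size s ->
  nth true bm i -> nth x0 s i \in mask bm s.
Proof.
elim: s bm i => [|x s IHs] [|b bm] // [|i] //= [sz] iS.
  by move=> ->; rewrite mem_head.
by move=> bi; case: b; rewrite ?inE IHs ?orbT.
Qed.

Lemma flatten_map_mask (T : Type) (U : eqType) (f : U -> seq T) x0 bm s : size bm = size s ->
  (forall i, i < size s -> ~~ nth true bm i -> f (nth x0 s i) = [::]) ->
  flatten (map f (mask bm s)) = flatten (map f s).
Proof.
elim: s bm => [|x s IHs] [|b bm] //= [sz] Hf.
have {}IHs := IHs _ sz (fun i => Hf i.+1).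
by case: b Hf => /= [_|/(_ 0 isT isT)->] //; rewrite IHs.
Qed.

Lemma lift_segments h m C Y : config h m.+1 C -> extends_segs (view m C) Y ->
  exists CY, [/\ view m CY = Y, all (old_path m) CY, sorted (link m.+2) CY,
    clip m.+1 CY = C & head pt0 (flatten CY) = (0, h.-1)].
Proof.
move=> HC [sY HY]; rewrite size_map in sY HY.
have HR i : i < size C -> exists y, [/\ view_path m y = nth [::] Y i,
    pieces (upto m.+1) y = [:: nth [::] C i], sorted adj y,
    (if i == 0 then head pt0 y = (0, h.-1) else in_col m.+2 (head pt0 y))
    & i.+1 < size C -> in_col m.+2 (last pt0 y)].
  move=> iC; apply: lift_segment => //.
  by have := HY i iC; rewrite /nth_seg (nth_map [::]).
have [CY sCY RCY] := choose_seq [::] HR.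
have oCY : all (old_path m) CY.
  apply/allP => p /(nthP [::])[i]; rewrite sCY => /RCY[_ ep sp _ _] <-.
  have hp : has (upto m.+1) (nth [::] CY i) by rewrite -[has _ _]negbK -pieces_eq0 ep.
  by rewrite /old_path /is_path sp hp; case: (nth _ _ _) hp.
have nCY : all (fun p => p != [::]) CY.
  by apply: sub_all oCY => p /andP[/andP[]].
exists CY; split => //.
- apply: (@eq_from_nth _ [::]); first by rewrite size_map sCY sY.
  by move=> i; rewrite size_map => iC; rewrite (nth_map [::]) //;
     rewrite sCY in iC; have [] := RCY i iC.
- apply/(sortedP [::]) => i; rewrite sCY => iC.
  have [_ _ _ _ /(_ iC) l] := RCY i (ltnW iC).
  have [_ _ _ hd _] := RCY i.+1 iC.
  apply/and3P; split => //; apply: (old_path_size (m := m)) => //.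
  by apply: (allP oCY); apply: mem_nth; rewrite sCY ltnW.
- rewrite /clip; have -> : map (pieces (upto m.+1)) CY = map (fun p => [:: p]) C.
    apply: (@eq_from_nth _ [::]); first by rewrite !size_map.
    move=> i; rewrite size_map => iC; rewrite (nth_map [::]) //.
    by rewrite sCY in iC; rewrite (nth_map [::]) //; have [] := RCY i iC.
  exact: flatten_seq1.
- have C0 : 0 < size C by have := config_neq0 HC; case: (C).
  by have [_ _ _ /= h0 _] := RCY 0 C0; rewrite head_flatten // -nth0.
Qed.

Lemma lift_inserts h m C Z CZ X :
    config h m.+1 C -> view m CZ = Z -> all (old_path m) CZ -> sorted (link m.+2) CZ ->
    clip m.+1 CZ = C -> head pt0 (flatten CZ) = (0, h.-1) -> inserts Z X ->
    X != [::] ->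
  exists CX, [/\ view m CX = X, all is_path CX, sorted (link m.+2) CX,
    clip m.+1 CX = C & head pt0 (flatten CX) = (0, h.-1)].
Proof.
move=> HC eZ oCZ lCZ cCZ hCZ [bm [sbm mX hbm new lastnew]] X0.
pose R i p := [/\ p != [::], sorted adj p, all (in_col m.+2) p & i.+1 < size X -> 1 < size p].
have [CX [eX mCX RX]] : exists CX, [/\ view m CX = X, mask bm CX = CZ
    & forall i, i < size X -> ~~ nth true bm i -> R i (nth [::] CX i)].
  apply: lift_mask; rewrite ?mX // => i iX /(new i iX)[c [ec c0 rc sc]].
  have /andP[su cu] := new_run_unshift m rc.
  exists (map (unshift m) c).
    rewrite -/(nth_seg X i) ec /view_path pieces_all //=.
    - by rewrite map_unshiftK.
    - by rewrite -size_eq0 size_map size_eq0.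
    - exact: from_unshift.
  split => //; first by rewrite -size_eq0 size_map size_eq0.
  by move=> lt; rewrite size_map; move: sc; rewrite (ltn_eqF lt).
have sCX : size CX = size X by rewrite -eX size_map.
have sb : size bm = size CX by rewrite sCX.
have CX0 : 0 < size CX by rewrite sCX; case: (X) X0.
have oldX i : i < size CX -> nth true bm i -> nth [::] CX i \in CZ.
  by move=> iX bi; rewrite -mCX mem_mask_nth.
have pX : all is_path CX.
  apply/allP => p /(nthP [::])[i iX <-]; case bi: (nth true bm i).
    by have /andP[] := allP oCZ _ (oldX i iX bi).
  by rewrite sCX in iX; have [p0 sp _ _] := RX i iX (negbT bi); rewrite /is_path p0.
have nCZ : all (fun p => p != [::]) CZ by apply: sub_all oCZ => p /andP[/andP[]].
have nCX : all (fun p => p != [::]) CX by apply: sub_all pX => p /andP[].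
have CZlink i : i.+1 < size CZ -> link m.+2 (nth [::] CZ i) (nth [::] CZ i.+1).
  by move=> iZ; apply: (sortedP [::] lCZ).
(* An old segment at a positive position has an old one before it, since the mask starts with
   [true]; the links of [CZ] then give the column of its head. *)
have heads i : 0 < i < size CX -> in_col m.+2 (head pt0 (nth [::] CX i)).
  move=> /andP[i0 iX]; case bi: (nth true bm i); last first.
    rewrite sCX in iX; have [p0 _ cp _] := RX i iX (negbT bi).
    by rewrite (allP cp) ?head_mem.
  case: CX sb mCX iX {eX RX sCX CX0 oldX pX nCX} => // x CX sb mCX iX.
  case: bm sb mCX hbm bi {sbm mX new lastnew} => // b bm [sb] /= mCX hb bi.
  rewrite hb /= in mCX; case: i i0 iX bi => // i _ iX bi.
  have := mem_mask_nth [::] sb iX bi => /(nthP [::])[k kZ ek].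
  have := CZlink k; rewrite -mCX /= ltnS ek => /(_ kZ) /and3P[_ + _].
  by [].
(* The delicate case is an old segment that is last in [CZ] but not in [CX]: the mask then ends with
   [false], and the last clause of [inserts] puts its end in the new column. *)
have lasts i : i.+1 < size CX -> in_col m.+2 (last pt0 (nth [::] CX i)).
  move=> iX; case bi: (nth true bm i); last first.
    have iX' : i < size X by rewrite -sCX ltnW.
    have [p0 _ cp _] := RX i iX' (negbT bi).
    by rewrite (allP cp) ?last_in.
  case/lastP: CX sb mCX iX {eX heads} RX sCX CX0 oldX pX nCX => // CX x.
  move=> sb mCX iX RX sCX CX0 oldX pX nCX.
  case/lastP: bm sb mCX hbm bi RX oldX lastnew {sbm mX new} => [|bm b]; first by rewrite size_rcons.
  rewrite !size_rcons => -[sb] mCX hb bi RX oldX lastnew.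
  rewrite size_rcons ltnS in iX; rewrite !nth_rcons sb iX in bi *.
  rewrite mask_rcons // in mCX.
  have := mem_mask_nth [::] sb iX bi => /(nthP [::])[k kZ ek].
  have szZ : size CZ = size (mask bm CX) + b by rewrite -mCX size_cat size_nseq.
  have ekZ : nth [::] CZ k = nth [::] CX i by rewrite -mCX nth_cat kZ.
  case: (ltnP k.+1 (size CZ)) => kZ'.
    by have /and3P[+ _ _] := CZlink k kZ'; rewrite ekZ.
  have b0 : b = false by move: kZ'; rewrite szZ; case: (b) => //; rewrite addn1 leqNgt ltnS kZ.
  rewrite last_rcons b0 in lastnew.
  have lastZ : last [::] CZ = nth [::] CX i.
    rewrite -(nth_last [::]) -ekZ; congr nth.
    have e : size CZ = k.+1 by apply/eqP; rewrite eqn_leq kZ' szZ b0 addn0.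
    by rewrite e.
  have inZ : nth [::] CX i \in CZ by rewrite -ekZ mem_nth // szZ b0 addn0.
  have /andP[/andP[p0 sp] _] := allP oCZ _ inZ.
  have := lastnew isT; rewrite -eZ /last_seg /view.
  rewrite -[X in last X]/(view_path m [::]) last_map lastZ seg_end_view_path /= => l2.
  by rewrite (last_window (m := m)) // /in_col; move: l2; clear; lia.
have sizes i : i.+1 < size CX -> 1 < size (nth [::] CX i).
  move=> iX; case bi: (nth true bm i).
    apply: (old_path_size (m := m)); last exact: lasts.
    by apply: (allP oCZ); apply: oldX => //; apply: ltnW.
  have iX' : i < size X by rewrite -sCX ltnW.
  by have [_ _ _ ->] := RX i iX' (negbT bi); rewrite // -sCX.
exists CX; split => //.
- apply/(sortedP [::]) => i iX; apply/and3P; split; first exact: lasts.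
    exact: heads.
  exact: sizes.
- rewrite -cCZ -mCX /clip (flatten_map_mask (x0 := [::])) // => i iX bi.
  by rewrite sCX in iX; have [_ _ cp _] := RX i iX bi; apply: pieces_out.
- rewrite -hCZ -mCX head_flatten // head_flatten; last by rewrite mCX.
  case: (CX) CX0 sb => // x CX' _; case: (bm) hbm => //= b bm' -> _.
  by [].
Qed.

Lemma lift_extension h m C X : config h m.+1 C -> extension h (view m C) X ->
  ~ removed h X ->
  exists C', [/\ config h m.+2 C', clip m.+1 C' = C & view m C' = X].
Proof.
move=> HC [_ frX [Y [Z [ext mer ins]]]] nrem.
have [CY [eY oCY lCY cCY hCY]] := lift_segments HC ext.
have [CZ [eZ oCZ lCZ cCZ fCZ]] := lift_merges mer (esym eY) oCY lCY.
have /and4P[_ uX gX cX] := frX.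
have X0 : X != [::] by case: (X) cX.
rewrite -fCZ in hCY; rewrite cCY in cCZ.
have [CX [eX pX lX cCX hX]] := lift_inserts HC eZ oCZ lCZ cCZ hCY ins X0.
have eC : flatten C = filter (upto m.+1) (flatten CX) by rewrite -cCX flatten_clip.
have nX : all (fun p => p != [::]) CX by apply: sub_all pX => p /andP[].
have CX0 : CX != [::] by apply: contra X0 => /eqP e; rewrite -eX e.
rewrite -eX points_view in uX gX cX.
have grid : all (in_grid m.+3 h) (flatten CX).
  apply/allP => v vX; case mv: (from m v).
    have /(allP gX) : shift m v \in map (shift m) (filter (from m) (flatten CX)).
      by apply: map_f; rewrite mem_filter mv.
    by move: mv; rewrite /in_grid /from /=; clear; lia.
  have : v \in flatten C.
    by rewrite eC mem_filter vX andbT /upto; move: mv; rewrite /from; clear; lia.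
  by move=> /(allP (config_grid HC)); rewrite /in_grid; clear; lia.
exists CX; split => //; split => //.
(* The window and the old columns overlap, so distinctness is checked vertex by vertex: all copies
   of a vertex lie in whichever of the two contains it. *)
- apply: count_mem_uniq => v; case vX: (v \in flatten CX); last exact/count_memPn/negbT.
  have uF : uniq (filter (from m) (flatten CX)) by apply: map_uniq uX.
  have uU : uniq (filter (upto m.+1) (flatten CX)) by rewrite -eC (config_uniq HC).
  case mv: (from m v).
    have := count_uniq_mem v uF; rewrite mem_filter mv vX /= => <-.
    by rewrite count_filter; apply: eq_count => w /=; case: eqP => //= ->.
  have uv : upto m.+1 v by move: mv; rewrite /upto /from; clear; lia.
  have := count_uniq_mem v uU; rewrite mem_filter uv vX /= => <-.
  by rewrite count_filter; apply: eq_count => w /=; case: eqP => //= ->.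
- move=> c cm; case: (ltnP c m.+2) => cm'.
    have /mapP[v vC ->] := config_col HC cm'.
    by apply: map_f; move: vC; rewrite eC mem_filter => /andP[].
  have /mapP[w] : 2 \in map fst (map (shift m) (filter (from m) (flatten CX))).
    by apply: (allP cX).
  move=> /mapP[v]; rewrite mem_filter => /andP[mv vX] -> /= ev.
  by apply/mapP; exists v => //; move: cm cm' ev; clear; lia.
set e := last pt0 (flatten CX) => /= etrap.
have eL : e = last pt0 (last [::] CX) by apply: last_flatten.
have eX' : e \in flatten CX.
  by apply: last_in; apply: contra CX0 => /eqP f0; case: (CX) f0 nX => // -[].
have egrid := allP grid _ eX'.
have segX : seg_end (last_seg X) = shift m (last pt0 (filter (from m) (last [::] CX))).
  by rewrite -eX /last_seg /view -[X in last X]/(view_path m [::]) last_map seg_end_view_path.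
(* An end in column [m] or further left is not examined by [removed]; it is already trapped in [C],
   and its neighbours all lie in the columns of [C]. *)
case: (ltnP m e.1) => em; last first.
  have uem : upto m.+1 e by rewrite /upto (leq_trans em).
  have ee : last pt0 (flatten C) = e.
    rewrite eC last_filter_in // (head_in_rev _ pt0) //.
    by apply: contraTneq eX' => ->.
  have := config_trap HC; rewrite /= ee ltnS em => /(_ isT) tr r rg er.
  have : r \in flatten C.
    by apply: tr => //; move: rg er em; rewrite /in_grid /adj /distn1; clear; lia.
  by rewrite eC mem_filter => /andP[].
have fe : last pt0 (filter (from m) (last [::] CX)) = e.
  rewrite eL; apply: last_filter_in; rewrite (head_in_rev _ pt0) -?eL /from ?(ltnW em) //.
  by apply: (allP nX); apply: last_in.
rewrite fe in segX.
have qr r : adj e r -> from m r by move: em; rewrite /from /adj /distn1; clear; lia.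
have := @trapped_view 3 h m CX e qr (ltnW em); rewrite addn3 eX -segX => -[+ _].
apply; apply: contrapT => ntr; apply: nrem; split => //.
rewrite segX /=.
(* Frame column 1 is the first alternative of [removed]; in column 2 the premise of the trapping
   clause leaves only a single point. *)
case: (ltnP e.1 m.+2) etrap => [e2 _|e2 /= /eqP s1]; first by left; move: em e2; clear; lia.
right; split; last by move: egrid e2; rewrite /in_grid; clear; lia.
rewrite -eX /single_point /last_seg /view -[X in last X]/(view_path m [::]) last_map.
rewrite flatten_view_path size_map; move: fe s1.
case: (last [::] CX) => // v [] //= + _.
by case: (from m v) => //= e0; move: em; rewrite -e0.
Qed.

(** * First frames and growing self-avoiding walks *)

Lemma view0 C : all (fun p => p != [::]) C -> view 0 C = map (fun p => [:: p]) C.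
Proof.
move=> nC; apply/eq_in_map => p /(allP nC) p0.
rewrite /view_path pieces_all //; last by apply/allP.
by rewrite /= map_id_in // => -[a b] _; rewrite /shift /= subn0.
Qed.

Lemma nth_seg1 C i : i < size C ->
  nth_seg (map (fun p => [:: p]) C) i = [:: nth [::] C i].
Proof. by move=> iC; rewrite /nth_seg (nth_map [::]). Qed.

Lemma last_seg1 C : C != [::] ->
  last_seg (map (fun p => [:: p]) C) = [:: last [::] C].
Proof. by case: C => // p C _; rewrite /last_seg /= last_map. Qed.

Lemma points1 C : points (map (fun p => [:: p]) C) = flatten C.
Proof. by rewrite /points flatten_seq1. Qed.

Lemma config_valid_first h C : config h 1 C -> valid_first_frame h (view 0 C).
Proof.
move=> HC; rewrite view0 ?(config_nonempty HC) //.
have C0 := config_neq0 HC; have sC : 0 < size C by rewrite lt0n size_eq0.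
rewrite /frame_trapped; split; rewrite ?size_map ?points1 ?last_seg1 //.
- by move=> i iC; rewrite nth_seg1.
- move=> i iC; rewrite nth_seg1 1?ltnW // /single_point /= cats0.
  by apply: contraL (config_size HC iC) => /eqP ->.
- by rewrite nth_seg1 // /seg_start /= -(config_head HC) head_flatten ?(config_nonempty HC) // nth0.
- split=> i iC; rewrite nth_seg1 /seg_start /seg_end /=.
  + exact: (config_start HC).
  + by case/andP: iC.
  + exact: (config_end HC).
  + exact: ltnW.
- have := config_trap HC; rewrite /= (config_last HC) /single_point /seg_end /= cats0.
  by move=> tr; split=> [e0|/eqP s1 e1];
    rewrite /frame_trapped points1 last_seg1 // /seg_end /=; apply: tr;
    rewrite ?e0 ?s1 ?orbT.
Qed.

Lemma valid_first_lift h F : is_frame 2 h F -> valid_first_frame h F ->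
  exists2 C, config h 1 C & view 0 C = F.
Proof.
move=> /and4P[segF uF gF cF] [size1 nsing start0 [starts ends] [trap0 trap1]].
pose C := map (head [::]) F.
have eF : F = map (fun p => [:: p]) C.
  apply: (@eq_from_nth _ [::]); first by rewrite !size_map.
  move=> i iF; rewrite !(nth_map [::]) ?size_map //.
  by have := size1 i iF; rewrite /nth_seg; case: (nth [::] F i) => // p [].
have sC : size F = size C by rewrite size_map.
have pC : all is_path C.
  apply/allP => p pC; have : [:: p] \in F by rewrite eF; apply: map_f.
  by move=> /(allP segF) /=; rewrite /is_segment /= andbT.
have nC : all (fun p => p != [::]) C by apply: sub_all pC => p /andP[].
exists C; last by rewrite view0.
rewrite /frame_trapped in trap0 trap1.
move: size1 nsing start0 starts ends trap0 trap1 uF gF cF; rewrite sC.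
move: (C) (F) eF pC nC => {F segF C sC} C F -> pC nC _ nsing start0 starts ends trap0 trap1.
rewrite points1 in trap0 trap1 * => uF gF cF.
have C0 : C != [::] by case: (C) cF.
have sC : 0 < size C by rewrite lt0n size_eq0.
split => //.
- by move=> c c1; apply: (allP cF); rewrite mem_iota.
- by move: start0; rewrite nth_seg1 // /seg_start /= nth0 head_flatten.
- apply/(sortedP [::]) => i iC; have iC' := ltnW iC.
  have := ends i iC; rewrite nth_seg1 // /seg_end /= => /eqP l1.
  have := starts i.+1 iC; rewrite nth_seg1 // /seg_start /= => /eqP h1.
  rewrite /link l1 h1 /=; have := nsing i iC; rewrite nth_seg1 // /single_point /= cats0.
  have : nth [::] C i != [::] by apply: (allP nC); apply: mem_nth.
  by case: (nth _ _ _) => // ? [].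
- rewrite /= last_flatten // => H.
  move: trap0 trap1; rewrite last_seg1 // /seg_end /single_point /= cats0.
  case: (ltnP (last pt0 (last [::] C)).1 1) H => [|e1 /= ->].
    by rewrite ltnS leqn0 => /eqP e0 _ /(_ e0).
  move=> _ /(_ isT); apply; apply/eqP; rewrite eqn_leq e1 andbT.
  have : last pt0 (last [::] C) \in flatten C.
    apply/flattenP; exists (last [::] C); first exact: last_in.
    by apply/last_in/(allP nC)/last_in.
  by move=> /(allP gF) /andP[].
Qed.

Lemma xmax_geq w v : v \in w -> v.1 <= xmax w.
Proof. by move=> vw; exact: (@leq_bigmax_seq _ w xpredT (fun p : point => p.1) v vw isT). Qed.

Lemma xmax_attained w : w != [::] -> exists2 v, v \in w & v.1 = xmax w.
Proof.
rewrite /xmax; elim: w => // v [|v' w] IHw _.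
  by exists v; rewrite ?mem_head // big_seq1.
have [u uw eu] := IHw isT; rewrite big_cons -eu.
case: (leqP v.1 u.1) => _; last by exists v; rewrite ?mem_head.
by exists u => //; rewrite inE uw orbT.
Qed.

Lemma displacement_xmax w r : head pt0 w = (0, r) -> displacement w = xmax w.
Proof.
rewrite /displacement /xmin; case: w => [|v w] /= [].
  by rewrite /xmax !big_nil.
by rewrite big_cons => ->; rewrite min0n subn0.
Qed.

(** A discrete intermediate value theorem: a step changes the column by at most one. *)
Lemma walk_columns w c : sorted adj w -> (head pt0 w).1 <= c -> c <= xmax w ->
  w != [::] -> c \in map fst w.
Proof.
move=> sw hw cw w0; have [z zw ez] := xmax_attained w0.
rewrite -ez in cw => {ez w0}.
elim: w sw hw zw => // v w IHw sw /= hw; rewrite inE.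
case: (eqVneq z v) => [ez _|_ /= zw]; first by rewrite inE eqn_leq hw -ez cw.
case: w IHw sw zw => // v' w IHw /= /andP[av sw] zw.
case: (ltngtP v.1 c) hw => // [vc _|-> _]; last by rewrite inE eqxx.
rewrite inE; apply/orP; right; apply: IHw => //.
by move: av vc; rewrite /adj /distn1 /=; clear; lia.
Qed.

Lemma adj_out j v v' : adj v v' -> upto j v -> ~~ upto j v' ->
  v' = right_of v /\ v.1 = j.
Proof.
case: v v' => [a b] [a' b']; rewrite /adj /distn1 /upto /right_of /= => ? ? ?.
by split; [congr (_, _)|]; lia.
Qed.

Section Gsaw.
Variables (h : nat) (w : seq point).
Hypotheses (gw : gsaw h w) (hw : head pt0 w = (0, h.-1)).

(** The strip is unbounded to the right, so the right neighbour of the trapped end is visited. This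
    is the origin of the accepting condition that the segment ends in the left column. *)
Lemma gsaw_last : (last pt0 w).1 < xmax w.
Proof.
have [w0 sw _ _ tw] := gw.
have lw : last pt0 w \in w by apply: last_in.
have : right_of (last pt0 w) \in w.
  apply: tw; last by rewrite adjC adj_right_of.
  exact: (allP sw _ lw).
exact: xmax_geq.
Qed.

(* The walk would enter and leave such a piece through the same point. *)
Lemma no_single_piece j u x v : 0 < j -> w = u ++ x :: v -> v != [::] ->
  upto j x -> ~~ head_in (upto j) v -> ~~ head_in (upto j) (rev u) -> False.
Proof.
have [_ _ aw uw _] := gw.
move=> j0 ew v0 xj; rewrite (head_inE _ pt0) // => hv hu.
move: aw uw; rewrite ew !(sorted_catE _ pt0) => /and3P[_ + aux].
rewrite -cat1s (sorted_catE _ pt0) (negbTE v0) /= => /andP[_ axv].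
have v0w : head pt0 v \in v by apply: head_mem.
have [ev xj1] := adj_out axv xj hv.
case: (eqVneq u [::]) ew => [-> ew _|u0 ew].
  by move: hw xj1; rewrite ew /= => -> /= j00; rewrite -j00 in j0.
rewrite (head_in_rev _ pt0) // in hu.
rewrite cat_uniq => /and3P[_ /hasP[]]; exists (last pt0 u); last exact: last_in.
move: aux; rewrite (negbTE u0) /= adjC => aux.
have [-> _] := adj_out aux xj hu; rewrite -ev inE v0w orbT //.
Qed.

Lemma config_gsaw j : 0 < j -> j <= xmax w -> config h j (clip j [:: w]).
Proof.
have [w0 sw aw uw tw] := gw => j0 jk.
have fC : flatten (clip j [:: w]) = filter (upto j) w.
  by rewrite flatten_clip /= cats0.
have eC : clip j [:: w] = pieces (upto j) w by rewrite /clip /= cats0.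
have splitC L1 q L2 : pieces (upto j) w = L1 ++ q :: L2 ->
    exists u v, [/\ w = u ++ q ++ v, pieces (upto j) u = L1, pieces (upto j) v = L2,
      ~~ head_in (upto j) (rev u) & ~~ head_in (upto j) v /\ (q != [::] /\ all (upto j) q)].
  move=> e; have [u [v [ew Lu Lv hu hv]]] := pieces_split e.
  exists u, v; split => //; split => //; apply: (@mem_pieces _ _ w).
  by rewrite e mem_cat mem_head orbT.
(* A piece followed by further points is left to the right, hence from column [j]; [no_single_piece]
   gives the second point. *)
have sizeq u q v : w = u ++ q ++ v -> v != [::] -> ~~ head_in (upto j) (rev u) ->
    ~~ head_in (upto j) v -> q != [::] -> all (upto j) q ->
    (last pt0 q).1 = j /\ 1 < size q.
  move=> ew v0 hu hv q0 qj; split.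
    move: aw; rewrite ew !(sorted_catE _ pt0) => /and3P[_ /and3P[_ _ +] _].
    rewrite (negbTE q0) (negbTE v0) /= => a.
    have qin : upto j (last pt0 q) by rewrite (allP qj) ?last_in.
    by rewrite (head_inE _ pt0) // in hv; have [_ ->] := adj_out a qin hv.
  case: q ew q0 qj => [|x [|y q]] // ew _ /andP[xj _].
  by case: (no_single_piece j0 ew v0 xj hv hu).
split.
- rewrite eC; apply/allP => q qw; have [q0 _] := mem_pieces qw.
  by rewrite /is_path q0 (allP (sorted_pieces (upto j) aw)).
- by rewrite fC filter_uniq.
- rewrite fC; apply/allP => v; rewrite mem_filter => /andP[vj /(allP sw)].
  by rewrite /in_grid /in_strip ltnS => ->; rewrite andbT.
- move=> c cj; have /mapP[v vw ec] : c \in map fst w.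
    by apply: walk_columns => //; rewrite ?hw // (leq_trans cj).
  by rewrite ec; apply: map_f; rewrite fC mem_filter vw /upto -ec cj.
- by rewrite fC head_filter_in // (head_inE _ pt0) // hw.
- rewrite eC; apply/(sortedP [::]) => i iC.
  set C := pieces _ w in iC *.
  have e1 : C = take i C ++ nth [::] C i :: nth [::] C i.+1 :: drop i.+2 C.
    by rewrite -!drop_nth ?cat_take_drop // ltnW.
  have e2 : C = rcons (take i C) (nth [::] C i) ++ nth [::] C i.+1 :: drop i.+2 C.
    by rewrite cat_rcons.
  have [u [v [ew Lu Lv hu [hv [q0 qj]]]]] := splitC _ _ _ e1.
  have v0 : v != [::] by case: (v) Lv.
  have [lq sq] := sizeq _ _ _ ew v0 hu hv q0 qj.
  apply/and3P; split => //; first exact/eqP.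
  have [u' [v' [ew' Lu' _ hu' [_ [r0 rj]]]]] := splitC _ _ _ e2.
  have u0 : u' != [::] by case: (u') Lu' => //; case: (take i C).
  move: aw; rewrite ew' !(sorted_catE _ pt0) => /and3P[_ _ +].
  rewrite (negbTE u0); move: (nth [::] C i.+1) r0 rj => r r0 rj.
  have -> : (r ++ v' == [::]) = false by case: (r) r0.
  have -> : head pt0 (r ++ v') = head pt0 r by case: (r) r0.
  rewrite /= adjC => a.
  have rin : upto j (head pt0 r) by rewrite (allP rj) ?head_mem.
  by rewrite (head_in_rev _ pt0) // in hu'; have [_ ->] := adj_out a rin hu'.
- rewrite fC eC /=; set e := last _ (filter _ _).
  have [L [q eL]] : exists L q, pieces (upto j) w = rcons L q.
    case/lastP: (pieces (upto j) w) (pieces_eq0 (upto j) w) => [|L q]; last by exists L, q.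
    rewrite eqxx => /esym/hasPn /(_ _ (head_mem pt0 w0)).
    by rewrite hw.
  have ee : e = last pt0 q.
    rewrite /e -flatten_pieces eL last_flatten -?eL ?pieces_nonempty //.
    by rewrite eL last_rcons.
  rewrite eL last_rcons => H.
  have e1 : pieces (upto j) w = L ++ q :: [::] by rewrite eL cats1.
  have [u [v [ew Lu Lv hu [hv [q0 qj]]]]] := splitC _ _ _ e1.
  (* If the walk went on after this last piece, the piece would end in column [j] with at least two
     points, against [H]; so the clipped end is the trapped end of the walk. *)
  case: (eqVneq v [::]) => v0; last first.
    have [lq sq] := sizeq _ _ _ ew v0 hu hv q0 qj.
    by move: H sq; rewrite ee lq ltnn /= => /eqP ->.
  have ew' : e = last pt0 w.
    by rewrite ee ew v0 cats0 last_cat; case: (q) q0.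
  rewrite ew' => r /andP[rj rh] ar; rewrite mem_filter /upto -ltnS rj /=.
  exact: tw.
Qed.

End Gsaw.

(** * Walks in the transfer digraph *)

Lemma uniq_grid_size w h s : uniq s -> all (in_grid w h) s -> size s <= w * h.
Proof.
move=> us gs; rewrite -[X in _ <= X * _](size_iota 0) -[X in _ <= _ * X](size_iota 0).
rewrite -(size_allpairs pair); apply: uniq_leq_size us _ => -[c r] /(allP gs) /andP[/= cw rh].
by apply/allpairsP; exists (c, r); rewrite /= !mem_iota !add0n.
Qed.

Lemma size_steps C : size (steps C) <= size (flatten C).
Proof.
elim: C => //= p C IHC; rewrite /steps /= !size_cat leq_add //.
by rewrite size_pairs leq_pred.
Qed.

Lemma n_edges_frame w h F : is_frame w h F -> n_edges F <= w * h.
Proof.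
move=> /and4P[_ uF gF _]; rewrite n_edgesE (leq_trans (size_steps _)) //.
exact: uniq_grid_size.
Qed.

Lemma is_walk_rcons (R : comNzRingType) (G : wdigraph R) (u v : vertex G) p e :
  is_walk u (rcons p e) v = is_walk u p (src e) && (tgt e == v).
Proof. by elim: p u => [|e' p IHp] u /=; rewrite ?IHp ?andbA // eq_sym. Qed.

Definition frame_of (i : nat) (C : seq (seq point)) : option raw_frame :=
  if i is m.+1 then Some (view m (clip i C)) else None.
(** Index 0 stands for the start vertex. Its value 0 makes the first increment count all edges in
    columns 0 and 1, including those within column 0. *)
Definition step_count (i : nat) (C : seq (seq point)) : nat :=
  if i is _.+1 then size (steps (clip i C)) else 0.
Definition trace (k : nat) (C : seq (seq point)) :=
  [seq (frame_of i C, frame_of i.+1 C, step_count i.+1 C - step_count i C) | i <- iota 0 k].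

(** Edges stripped of their proofs, so that they can be compared with the entries of a [trace]; by
    [raw_edge_inj] nothing is lost. *)
Definition raw_edge h (e : edge (D h)) : option raw_frame * option raw_frame * nat :=
  let u := (val (e : Dedge h)) in
  (omap (@frame_val 2 h) u.1.1, omap (@frame_val 2 h) u.1.2, nat_of_ord u.2).

Lemma raw_edge_inj h : injective (@raw_edge h).
Proof.
move=> e e' [e1 e2 e3]; apply: val_inj.
have oinj : injective (omap (@frame_val 2 h)).
  by move=> [F|] [F'|] //= [/val_inj ->].
move: e e' e1 e2 e3 => [[[u v] n] pe] [[[u' v'] n'] pe'] /= /oinj -> /oinj -> nn.
by congr (_, _, _); apply: val_inj.
Qed.

Lemma D_edge h u v n : is_Dedge u v n -> n <= 3 * h ->
  exists e : edge (D h), [/\ src e = u, tgt e = v &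
    raw_edge e = (omap (@frame_val 2 h) u, omap (@frame_val 2 h) v, n)].
Proof.
move=> uvn n3h; have n3 : n < (3 * h).+1 by [].
have pr : `[< @is_Dedge h u v (Ordinal n3) >] by apply/asboolP.
by exists (exist _ (u, v, Ordinal n3) pr).
Qed.

Lemma D_edgeP h (e : edge (D h)) : is_Dedge (src e) (tgt e) (raw_edge e).2.
Proof. by case: e => e pe; exact/asboolP. Qed.

Lemma raw_edgeE h (e : edge (D h)) : raw_edge e =
  (omap (@frame_val 2 h) (src e), omap (@frame_val 2 h) (tgt e), (raw_edge e).2).
Proof. by []. Qed.

(** Adding columns on the right does not change the earlier entries, which lets the trace grow along
    the induction in [walk_config]. *)
Lemma trace_clip j C : trace j (clip j C) = trace j C.
Proof.
apply/eq_in_map => i; rewrite mem_iota add0n => /= ij.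
by case: i ij => [|i] ij; rewrite /frame_of /step_count !clip_clip // ltnW.
Qed.

Lemma trace_rcons k C : trace k.+1 C = rcons (trace k C)
  (frame_of k C, frame_of k.+1 C, step_count k.+1 C - step_count k C).
Proof. by rewrite /trace -[in LHS]addn1 iotaD map_cat cats1. Qed.

(** Telescoping; the truncated differences are exact because the number of steps grows with the
    columns. *)
Lemma sum_trace k C : sumn (map snd (trace k C)) = step_count k C.
Proof.
elim: k => // k IHk; rewrite trace_rcons map_rcons sumn_rcons IHk /= subnKC //.
case: k {IHk} => // k; rewrite /step_count !steps_clip !size_filter.
apply: sub_count => -[v v'] /andP[/= vk vk'].
by apply/andP; split; apply: leqW.
Qed.

Lemma config_clip h j C : config h j C -> clip j C = C.
Proof. by move=> HC; rewrite clip_id ?(config_path HC) ?(config_upto HC). Qed.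

Lemma n_edges_view0 C : n_edges (view 0 C) = size (steps C).
Proof. by rewrite n_edges_view; apply/eqP; rewrite -all_count; apply/allP. Qed.

Lemma walk_config h (p : seq (edge (D h))) (u : Dvertex h) :
  is_walk (Dstart h) p u -> p != [::] ->
  exists C (F : frame 2 h), [/\ u = Some F, config h (size p) C,
    frame_val F = view (size p).-1 C & map (@raw_edge h) p = trace (size p) C].
Proof.
elim/last_ind: p u => // p e IHp u.
rewrite is_walk_rcons => /andP[we /eqP eu] _; have := D_edgeP e.
have er := raw_edgeE e.
case: (eqVneq p [::]) => [p0|pn]; rewrite size_rcons.
  have es : src e = None by rewrite p0 in we; move/eqP: we.
  rewrite eu es in er *; case: u eu er => [F|] //= _ er [vF en].
  have [C HC eF] := valid_first_lift (F := frame_val F) (valP F) vF.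
  exists C, F; rewrite p0 /=; split => //.
  by rewrite er en /trace /= (config_clip HC) eF subn0 -eF n_edges_view0.
have [C0 [F0 [es HC0 eF0 ep]]] := IHp _ we pn.
rewrite eu es in er *; case: u eu er => [F|] //= _ er [X [ext nrem eF en]].
case sp: (size p) HC0 eF0 ep => [|m] HC0 eF0 ep.
  by move: pn; rewrite -size_eq0 sp.
rewrite /= in eF0; rewrite eF0 in ext en.
have [C [HC cC eX]] := lift_extension HC0 ext nrem.
exists C, F; split => //; first by rewrite -eF -eX trim_view.
rewrite map_rcons ep (trace_rcons m.+1 C) -cC trace_clip er; congr (rcons _ (_, _, _)).
- by rewrite /= eF0 cC.
- by rewrite /frame_of (config_clip HC) -trim_view eX eF.
- rewrite /step_count (config_clip HC) cC en -eX.
  have := n_edges_step (m := m) (config_path HC) (config_upto HC).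
  by rewrite cC => ->; rewrite addKn.
Qed.

Lemma gsaw_walk h w j : gsaw h w -> head pt0 w = (0, h.-1) -> j < xmax w ->
  exists (p : seq (edge (D h))) (F : frame 2 h),
    [/\ is_walk (Dstart h) p (Some F), frame_val F = view j (clip j.+1 [:: w])
      & map (@raw_edge h) p = trace j.+1 [:: w]].
Proof.
move=> gw hw; elim: j => [|j IHj] jk.
  have HC := config_gsaw gw hw (ltn0Sn 0) jk; set C := clip 1 _ in HC *.
  have frC : is_frame 2 h (view 0 C) by apply: (view_is_frame HC).
  pose F : frame 2 h := Frame frC.
  have n3 : n_edges F <= 3 * h.
    by rewrite (leq_trans (n_edges_frame frC)) // leq_mul2r orbT.
  have dF : @is_Dedge h None (Some F) (n_edges F) by split => //; apply: config_valid_first.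
  have [e [es et er]] := D_edge dF n3.
  exists [:: e], F; split => //; first by rewrite -[[:: e]]/(rcons [::] e) is_walk_rcons es et !eqxx.
  by rewrite /= er /trace /= subn0 n_edges_view0.
have [p [F [wp eF rp]]] := IHj (ltnW jk).
have HC := config_gsaw gw hw (ltn0Sn j) (ltnW jk).
have HC' := config_gsaw gw hw (ltn0Sn j.+1) jk.
have cC : clip j.+1 (clip j.+2 [:: w]) = clip j.+1 [:: w] by rewrite clip_clip.
set C := clip j.+1 _ in HC cC eF; set C' := clip j.+2 _ in HC' cC *.
have frC : is_frame 2 h (view j.+1 C') by apply: (view_is_frame HC'); rewrite ?addn2.
have frX : is_frame 3 h (view j C') by apply: (view_is_frame HC'); rewrite ?addn3.
pose F' : frame 2 h := Frame frC.
have n3 : n_edges (view j C') - n_edges F <= 3 * h.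
  by rewrite (leq_trans (leq_subr _ _)) // n_edges_frame.
have dF : @is_Dedge h (Some F) (Some F') (n_edges (view j C') - n_edges F).
  exists (view j C'); split => //; last exact: trim_view.
    by rewrite eF; apply: extension_view.
  exact: view_not_removed HC'.
have [e [es et er]] := D_edge dF n3.
exists (rcons p e), F'; split => //.
  by rewrite is_walk_rcons es et wp eqxx.
rewrite map_rcons rp (trace_rcons j.+1) er; congr (rcons _ (_, _, _)).
  by rewrite /= eF.
rewrite /step_count -/C -/C' /= eF.
have := n_edges_step (m := j) (config_path HC') (config_upto HC').
by rewrite cC => ->; rewrite addKn.
Qed.

Lemma adj_leq (a b : point) k : adj a b -> a.1 < k -> b.1 <= k.
Proof. by rewrite /adj /distn1; lia. Qed.

Lemma adj_window k (a b : point) : 0 < k -> upto k a -> upto k b -> adj a b ->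
  exists i, [/\ i < k, from i a, from i b, upto i.+1 a & upto i.+1 b].
Proof.
rewrite /adj /distn1 /from /upto => k0 ak bk ab.
(* The larger of the two columns is the right column of the window; when both are 0, the truncated
   predecessor gives the first window. *)
by exists (maxn a.1 b.1).-1; split; lia.
Qed.

Lemma trace_inj k w w' : 0 < k -> sorted adj w -> sorted adj w' -> uniq w -> uniq w' ->
  all (upto k) w -> all (upto k) w' -> w != [::] -> w' != [::] ->
  head pt0 w = head pt0 w' -> trace k [:: w] = trace k [:: w'] -> w = w'.
Proof.
move=> k0 sw sw' uw uw' kw kw' w0 w0' hw et.
have {}et i : i < k -> view i (clip i.+1 [:: w]) = view i (clip i.+1 [:: w']).
  move=> ik; move: et => /(congr1 (fun s => nth (None, None, 0) s i)).
  by rewrite /trace !(nth_map 0) ?size_iota // nth_iota // add0n => -[].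
have sub x x' :
    (forall i, i < k -> view i (clip i.+1 [:: x]) = view i (clip i.+1 [:: x'])) ->
    sorted adj x -> all (upto k) x -> {subset pairs x <= pairs x'}.
  move=> ev sx kx [a b] abx; have [ax bx] := mem_pairs abx.
  have aab : adj a b by rewrite sorted_pairs in sx; exact: (allP sx _ abx).
  have [i [ik fa fb ua ub]] := adj_window k0 (allP kx _ ax) (allP kx _ bx) aab.
  have := congr1 (fun F => steps (flatten F)) (ev i ik) => /=.
  rewrite !steps_view !steps_clip /steps /= !cats0 => E.
  have : (shift i a, shift i b) \in map (fun xy => (shift i xy.1, shift i xy.2))
      (filter (both (from i)) (filter (both (upto i.+1)) (pairs x'))).
    rewrite -E; apply/mapP; exists (a, b) => //.
    by rewrite !mem_filter /both /= fa fb ua ub.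
  case/mapP => -[a' b']; rewrite !mem_filter /both /=.
  case/and3P=> /andP[fa' fb'] _ abx' [ea1 ea2 eb1 eb2].
  have ea : a = a' by apply: (shift_inj fa fa'); congr (_, _).
  have eb : b = b' by apply: (shift_inj fb fb'); congr (_, _).
  by rewrite ea eb.
have E : pairs w =i pairs w'.
  by move=> ab; apply/idP/idP; apply: sub => // i ik; rewrite et.
case: w w0 hw uw E {sw kw et sub} => // v w _ /= ev uw E.
case: w' w0' ev uw' E {sw' kw'} => // v' w' _ /= ev uw' E.
by rewrite -ev in uw' E *; rewrite (eq_from_pairs uw uw' E).
Qed.

Lemma gsaw_props h w : gsaw h w -> [/\ w != [::], sorted adj w, uniq w & all (upto (xmax w)) w].
Proof.
move=> [w0 _ sw uw _]; split => //; apply/allP => v vw; exact: xmax_geq.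
Qed.

Lemma accepted_gsaw h (p : seq (edge (D h))) (t : Dvertex h) :
  is_walk (Dstart h) p t -> Daccepting (t : vertex (D h)) ->
  exists w, [/\ gsaw h w, head pt0 w = (0, h.-1), xmax w = size p,
    (size w).-1 = sumn [seq (raw_edge e).2 | e <- p]
    & map (@raw_edge h) p = trace (size p) [:: w]].
Proof.
case: (eqVneq p [::]) => [-> /eqP <- //|pn] wp acc.
have [C [F [et HC eF rp]]] := walk_config wp pn.
rewrite et /= eF size_map in acc; case/andP: acc => /eqP sC /eqP e0.
have [w eC] : exists w, C = [:: w] by case: (C) sC => // w []; exists w.
rewrite eC in HC e0 rp.
have [w0 sw uw kw] := config_mem HC (mem_head _ _).
have p0 : 0 < size p by rewrite lt0n size_eq0.
have gridw v : v \in w -> v.1 <= size p /\ v.2 < h.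
  by move=> vw; have := allP (config_grid HC) v; rewrite /= cats0 => /(_ vw)/andP[].
have hw : head pt0 w = (0, h.-1) by have := config_head HC; rewrite /= cats0.
(* If the walk ended in the right column of the last frame, its segment would end there too, and not
   in column 0. *)
have ew : (last pt0 w).1 < size p.
  rewrite ltnNge; apply: contra_eqN e0 => le.
  have fl : from (size p).-1 (last pt0 w).
    by rewrite /from (leq_trans (leq_pred _)).
  rewrite /last_seg /= seg_end_in ?(head_in_rev _ pt0) //= subn_eq0 -ltnNge.
  by rewrite (leq_trans _ le) // prednK.
have tw := config_trap HC; rewrite /= cats0 ew /= in tw.
exists w; split => //.
- split=> //; first by apply/allP => v /gridw[].
  (* As the end is left of the last column, its neighbours stay inside the configuration, and being
     trapped in the grid means being trapped in the strip. *)
  move=> v vh av; apply: (tw isT _ _ av); rewrite /in_grid; apply/andP; split => //.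
  exact: adj_leq av ew.
- apply/eqP; rewrite eqn_leq; apply/andP; split.
    by have [v vw <-] := xmax_attained w0; have [] := gridw v vw.
  have := config_col HC (leqnn _); rewrite /= cats0 => /mapP[v vw ->].
  exact: xmax_geq.
- have := sum_trace (size p) [:: w]; rewrite -rp -map_comp /= => ->.
  case: (size p) p0 HC => // k _ HC; rewrite /step_count (config_clip HC).
  by rewrite /steps /= cats0 size_pairs.
Qed.

Lemma gsaw_accepted h w : gsaw h w -> head pt0 w = (0, h.-1) ->
  exists (p : seq (edge (D h))) (t : Dvertex h),
    [/\ is_walk (Dstart h) p t, Daccepting (t : vertex (D h)), size p = xmax w
      & map (@raw_edge h) p = trace (xmax w) [:: w]].
Proof.
move=> gw hw; have lw := gsaw_last gw.
case ek: (xmax w) lw => [|k] // lw.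
have [|p [F [wp eF rp]]] := gsaw_walk (j := k) gw hw; first by rewrite ek.
have [w0 sw uw kw] := gsaw_props gw.
have cw : clip k.+1 [:: w] = [:: w] by rewrite clip_id //= ?cats0 -?ek // /is_path w0 sw.
exists p, (Some F); split => //.
  rewrite /= eF cw /= seg_end_view_path /= subn_eq0.
  (* By [last_window], a segment end outside the left column would be the end of the walk, against
     [gsaw_last]. *)
  rewrite leqNgt; apply/negP => lt; have := last_window sw lt => e.
  by move: lw; rewrite e ltnNge lt.
by rewrite -(size_map (@raw_edge h)) rp size_map size_iota.
Qed.

(** * Power series and the transfer matrix *)

Import GRing.Theory.

Section PowerSeries.
Local Open Scope ring_scope.

Definition constant_coef (R : comNzRingType) (f : fps R) : R := fcoef f 0.

Lemma constant_coef_is_additive (R : comNzRingType) :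
  zmod_morphism (@constant_coef R).
Proof. by []. Qed.

Lemma constant_coef_is_multiplicative (R : comNzRingType) :
  monoid_morphism (@constant_coef R).
Proof. by split=> // f g; rewrite /constant_coef /= big_ord1. Qed.

HB.instance Definition _ (R : comNzRingType) := GRing.isZmodMorphism.Build
  (fps R) R (@constant_coef R) (@constant_coef_is_additive R).
HB.instance Definition _ (R : comNzRingType) := GRing.isMonoidMorphism.Build
  (fps R) R (@constant_coef R) (@constant_coef_is_multiplicative R).

Lemma fps_unit_constant_coef (R : comUnitRingType) (f : fps R) :
  constant_coef f \is a GRing.unit -> f \is a GRing.unit.
Proof.
rewrite /constant_coef; set a := fcoef f 0 => ua.
(* [next s] solves the convolution equation for the coefficient of the inverse that follows those
   listed in [s]; [gs] accumulates the list, as each coefficient depends on all earlier ones. *)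
pose next s := a^-1 * ((size s == 0)%:R - \sum_(i < size s) s`_i * fcoef f (size s - i)).
pose gs := fix gs n := if n is n'.+1 then rcons (gs n') (next (gs n')) else [::].
have szg n : size (gs n) = n by elim: n => //= n IHn; rewrite size_rcons IHn.
pose g n := next (gs n).
have gsE n i : (i < n)%N -> (gs n)`_i = g i.
  elim: n => // n IHn; rewrite ltnS leq_eqVlt => /orP[/eqP->|lt] /=.
    by rewrite nth_rcons szg ltnn eqxx.
  by rewrite nth_rcons szg lt IHn.
suff : FPS g * f = 1 by move=> gf; exact: (fps_unitPl gf).
apply: fpsP => n; rewrite /= big_ord_recr /= subnn -/a.
rewrite {2}/g /next szg mulrAC mulVr // mul1r.
have -> : \sum_(i < n) (gs n)`_i * fcoef f (n - i) = \sum_(i < n) g i * fcoef f (n - i).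
  by apply: eq_bigr => i _; rewrite gsE.
by rewrite addrC subrK.
Qed.

Lemma fcoef_mulX (R : comNzRingType) (f : fps R) n :
  fcoef (FPS (fun n => (n == 1)%:R) * f) n = if n is m.+1 then fcoef f m else 0.
Proof.
case: n => [|n] /=; first by rewrite big_ord1 mul0r.
rewrite !big_ord_recl /= mul0r add0r mul1r big1 ?addr0 //.
  by rewrite subSS subn0.
by move=> i _; rewrite mul0r.
Qed.

Lemma fcoef_Xn (R : comNzRingType) m n :
  fcoef (FPS (fun n => (n == 1)%:R) ^+ m : fps R) n = (n == m)%:R.
Proof.
elim: m n => [|m IHm] n; first by [].
by rewrite exprS fcoef_mulX; case: n.
Qed.

Lemma fcoef_mul_y (f : fps_xy) n :
  fcoef (fps_y * f) n = FPS (fun k => (k == 1)%:R) * fcoef f n.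
Proof.
rewrite [LHS]/= big_ord_recl subn0 big1 ?addr0 //.
by move=> i _; rewrite /= mul0r.
Qed.

Lemma fcoef_monomial a b n k :
  fcoef (fcoef (fps_x ^+ a * fps_y ^+ b) n) k = ((n == a) && (k == b))%:R.
Proof.
have -> : fcoef (fps_x ^+ a * fps_y ^+ b) n =
    FPS (fun k => (k == 1)%:R) ^+ b * (n == a)%:R.
  elim: b => [|b IHb]; first by rewrite !expr0 mulr1 mul1r /fps_x fcoef_Xn.
  by rewrite exprS mulrCA fcoef_mul_y IHb exprS mulrA.
by case: (n == a); rewrite ?mulr1 ?mulr0 // fcoef_Xn.
Qed.

Lemma monomial_inj a b a' b' :
  fps_x ^+ a * fps_y ^+ b = fps_x ^+ a' * fps_y ^+ b' -> a = a' /\ b = b'.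
Proof.
move=> /(congr1 (fun f => fcoef (fcoef f a) b)); rewrite !fcoef_monomial !eqxx /=.
by case: eqP => [->|]; case: eqP => [->|].
Qed.

Lemma fcoef_sum (R : comNzRingType) (I : Type) (r : seq I) (P : pred I) (F : I -> fps R) n :
  fcoef (\sum_(i <- r | P i) F i) n = \sum_(i <- r | P i) fcoef (F i) n.
Proof. by elim/big_rec2: _ => // i x y _ <-. Qed.

(** The hypothesis is divisibility of [f] by [y ^ k.+1]; the lemma serves to discard the remainder
    of a geometric sum. *)
Lemma fcoef_mul_order (f g : fps_xy) k :
    (forall n j, (j <= k)%N -> fcoef (fcoef f n) j = 0) ->
  forall n, fcoef (fcoef (f * g) n) k = 0.
Proof.
move=> f0 n; rewrite /= fcoef_sum big1 // => i _ /=.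
by rewrite big1 // => j _; rewrite f0 ?mul0r // -ltnS.
Qed.

End PowerSeries.

(** * Walk sums and powers of the transfer matrix *)

Section TransferMatrix.
Local Open Scope ring_scope.
Variables (R : comNzRingType) (G : wdigraph R).

Fixpoint words n : seq (seq (edge G)) :=
  if n is n'.+1 then [seq e :: p | e <- enum (edge G), p <- words n'] else [:: [::]].

Lemma mem_words n p : (p \in words n) = (size p == n).
Proof.
elim: n p => [|n IHn] [|e p] //=; first by apply/negbTE/allpairsPdep => -[? [? []]].
rewrite eqSS -IHn; apply/allpairsPdep/idP => [[e' [p' [_ p'n [_ ->]]]] //|pn].
by exists e, p; rewrite mem_enum.
Qed.

Lemma uniq_words n : uniq (words n).
Proof.
elim: n => //= n IHn; apply: allpairs_uniq => //; first exact: enum_uniq.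
by move=> [e p] [e' p'] _ _ /= [-> ->].
Qed.

Definition transfer_pow n := iter n (mulmx (transfer_mx G)) 1%:M.

Lemma transfer_powE n i j : transfer_pow n i j =
  \sum_(p <- words n | is_walk (enum_val i) p (enum_val j)) walk_weight p.
Proof.
elim: n i => [|n IHn] i.
  rewrite /= big_mkcond big_seq1 mxE /walk_weight big_nil /= (inj_eq enum_val_inj).
  by case: (i == j).
rewrite /= mxE [RHS]big_mkcond big_allpairs_dep big_enum /=.
(* Both sides are grouped by the first edge [e]; the summation index of the matrix product is then
   forced to be the rank of [tgt e]. *)
transitivity (\sum_(e | src e == enum_val i) wt e *
   \sum_(p <- words n | is_walk (tgt e) p (enum_val j)) walk_weight p).
  under eq_bigr => l _ do rewrite mxE IHn big_distrl /=.
  rewrite (exchange_big_dep (fun e => src e == enum_val i)) /=; last by move=> l e _ /andP[].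
  apply: eq_bigr => e /eqP ei.
  rewrite (big_pred1 (enum_rank (tgt e))) ?enum_rankK // => l /=.
  rewrite ei eqxx /=; apply/eqP/eqP => [->|->]; by rewrite ?enum_valK ?enum_rankK.
rewrite [LHS]big_mkcond; apply: eq_bigr => e _; rewrite -big_mkcond /=.
case: (src e == _); last by rewrite big_pred0.
by rewrite big_distrr; apply: eq_bigr => p _; rewrite /walk_weight big_cons.
Qed.

Lemma transfer_pow_sum n :
  (1%:M - transfer_mx G) *m (\sum_(i < n) transfer_pow i) = 1%:M - transfer_pow n.
Proof.
elim: n => [|n IHn]; first by rewrite big_ord0 mulmx0 subrr.
by rewrite big_ord_recr mulmxDr IHn mulmxBl mul1mx addrA subrK.
Qed.

(** A word can end at one vertex only, so the existential over end vertices becomes a function, and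
    acceptance a boolean test on words. *)
Lemma is_walk_end (u v : vertex G) p : is_walk u p v =
  is_walk u p (last u (map (@tgt _ G) p)) && (last u (map (@tgt _ G) p) == v).
Proof.
elim: p u => [|e p IHp] u /=; first by rewrite eqxx.
by rewrite IHp andbA.
Qed.

End TransferMatrix.

(** * The bijection and its consequences for cardinalities *)

Definition walk_end h (p : seq (edge (D h))) : vertex (D h) :=
  last (Dstart h) (map (@tgt _ (D h)) p).
Definition walk_steps h (p : seq (edge (D h))) : nat :=
  sumn [seq (raw_edge e).2 | e <- p].
Definition accepted h (p : seq (edge (D h))) : bool :=
  is_walk (Dstart h) p (walk_end p) && Daccepting (walk_end p).

Lemma walk_weight_D h (p : seq (edge (D h))) :
  walk_weight p = (fps_x ^+ walk_steps p * fps_y ^+ size p)%R.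
Proof.
elim: p => [|e p IHp]; first by rewrite /walk_weight big_nil mulr1.
rewrite /walk_weight big_cons -/(walk_weight p) IHp /walk_steps /= exprD exprS.
by rewrite mulrACA.
Qed.

Lemma accepted_walksE h n k (p : seq (edge (D h))) : accepted_walks h n k p <->
  [/\ accepted p, walk_steps p = n & size p = k].
Proof.
split=> [[t [acc wp]]|[/andP[wp acc] pn pk]].
  rewrite walk_weight_D => /monomial_inj[-> ->]; move: wp.
  by rewrite is_walk_end => /andP[wp /eqP et]; rewrite /accepted /walk_end wp et.
by exists (walk_end p); rewrite walk_weight_D pn pk.
Qed.

Lemma walks_bijection h n k :
  exists f : seq (edge (D h)) -> seq point,
    set_bij (accepted_walks h n k) (gsaws h n k) f.
Proof.
(* The correspondence is equality of traces: injectivity comes from [raw_edge_inj], and [trace_inj]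
   identifies the chosen preimage in the proof of surjectivity. *)
pose codes p w := gsaws h n k w /\ map (@raw_edge h) p = trace k [:: w].
pose f p := xget [::] (codes p).
have disp w : gsaws h n k w ->
    [/\ gsaw h w, head pt0 w = (0, h.-1), xmax w = k & (size w).-1 = n].
  by move=> [gw hw sw dw]; rewrite -(displacement_xmax hw).
have fP p : accepted_walks h n k p -> codes p (f p).
  move=> /accepted_walksE[/andP[wp acc] pn pk].
  have [w [gw hw xw sw rw]] := accepted_gsaw wp acc.
  apply: (@xgetPex _ [::] (codes p)); exists w; rewrite /codes -pk; split => //.
  by split => //; rewrite ?(displacement_xmax hw) // sw.
exists f; split.
- by move=> p /fP[].
- move=> p p'; rewrite !inE => /fP[_ rp] /fP[_ rp'] e.
  by apply: (inj_map (@raw_edge_inj h)); rewrite rp rp' e.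
- move=> w gw; have [ww hw xw sw] := disp w gw.
  have [p [t [wp acc sp rp]]] := gsaw_accepted ww hw.
  move: wp; rewrite is_walk_end => /andP[wp /eqP et].
  have ap : accepted_walks h n k p.
    apply/accepted_walksE; rewrite -xw -sp /accepted /walk_end et -{1}et wp acc; split => //.
    have := sum_trace (xmax w) [:: w]; rewrite -rp -map_comp -/(walk_steps p) => e.
    have [w0 aw uw kw] := gsaw_props ww.
    have := gsaw_last ww; rewrite -sw {}e; case: (xmax w) kw => // m kw _.
    have cw : clip m.+1 [:: w] = [:: w] by rewrite clip_id //= ?cats0 // /is_path w0 aw.
    by rewrite /step_count cw /steps /= cats0 size_pairs.
  exists p => //; have [gfp rfp] := fP p ap.
  have [ww' hw' xw' _] := disp _ gfp.
  have [w0 aw uw kw] := gsaw_props ww; have [w0' aw' uw' kw'] := gsaw_props ww'.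
  rewrite xw in kw rp; rewrite xw' in kw'.
  apply: (@trace_inj k) => //; last by rewrite -rp.
    by rewrite -xw (leq_trans _ (gsaw_last ww)).
  by rewrite hw hw'.
Qed.

Definition accepted_words h n k : seq (seq (edge (D h))) :=
  [seq p <- words (D h) k | accepted p && (walk_steps p == n)].

Lemma mem_accepted_words h n k p :
  p \in accepted_words h n k <-> accepted_walks h n k p.
Proof.
rewrite mem_filter mem_words accepted_walksE; split.
  by move=> /andP[/andP[ap /eqP pn] /eqP pk].
by move=> [-> -> ->]; rewrite !eqxx.
Qed.

(** Finiteness comes from the words of length [k] over the finite edge set and is carried over by
    the bijection. *)
Lemma gsaws_seq h n k : exists2 s : seq (seq point),
  gsaws h n k = [set` s]%classic & uniq s /\ size s = size (accepted_words h n k).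
Proof.
have [f [fun_f inj_f surj_f]] := walks_bijection h n k.
exists (map f (accepted_words h n k)); last first.
  rewrite size_map map_inj_in_uniq ?filter_uniq ?uniq_words //.
  by move=> p p' /mem_accepted_words ap /mem_accepted_words ap'; apply: inj_f; rewrite inE.
apply/seteqP; split=> [w /surj_f[p /mem_accepted_words pw <-]|w] /=.
  exact: map_f.
by move=> /mapP[p /mem_accepted_words ap ->]; apply: fun_f.
Qed.

Lemma gsaws_finite h n k : finite_set (gsaws h n k).
Proof. by have [s -> _] := gsaws_seq h n k; apply: finite_seq. Qed.

Lemma card_gsaws h n k : #|` fset_set (gsaws h n k)|%fset = size (accepted_words h n k).
Proof.
have [s es [us ss]] := gsaws_seq h n k.
rewrite -ss -(undup_id us) -card_fseq; congr (#|` _|%fset).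
apply/fsetP => w; rewrite es in_fset_set; last exact: finite_seq.
rewrite inE; by apply/idP/idP; rewrite in_setE.
Qed.

(** * Coefficients of the inverse matrix and the generating function *)

Section GeneratingFunction.
Local Open Scope ring_scope.

Lemma transfer_unit h : 1%:M - transfer_mx (D h) \in unitmx.
Proof.
(* The determinant commutes with taking the constant coefficient in x and then in y, and the
   constant coefficient of every weight [x ^ n * y] vanishes. *)
rewrite unitmxE; do 2!apply: fps_unit_constant_coef; rewrite -!det_map_mx.
set A := map_mx _ _; suff -> : A = 1%:M by rewrite det1 unitr1.
apply/matrixP => i j; rewrite !mxE !rmorphB /= /constant_coef !fcoef_sum.
rewrite big1 ?subr0 => [|e _]; first by case: (i == j).
by rewrite -[fps_y]expr1 fcoef_monomial andbF.
Qed.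

Lemma coef_transfer_pow h m i j n k :
  fcoef (fcoef (@transfer_pow _ (D h) m i j) n) k =
  \sum_(p <- words (D h) m | is_walk (enum_val i) p (enum_val j))
     ((n == walk_steps p) && (k == m))%:R.
Proof.
rewrite transfer_powE !fcoef_sum big_seq_cond [RHS]big_seq_cond.
apply: eq_bigr => p; rewrite mem_words => /andP[/eqP sp _].
by rewrite walk_weight_D fcoef_monomial sp.
Qed.

(* The powers above the k-th one do not contribute to the coefficient of y^k. *)
Lemma coef_invmx h i j n k :
  fcoef (fcoef (invmx (1%:M - transfer_mx (D h)) i j) n) k =
  \sum_(p <- words (D h) k | is_walk (enum_val i) p (enum_val j))
     (n == walk_steps p)%:R.
Proof.
set A := 1%:M - _.
(* A finite geometric sum with remainder replaces the infinite series; the remainder has the factor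
   [transfer_pow k.+1], which is divisible by [y ^ k.+1]. *)
have : invmx A =
    \sum_(m < k.+1) @transfer_pow _ (D h) m + invmx A *m @transfer_pow _ (D h) k.+1.
  have := congr1 (mulmx (invmx A)) (transfer_pow_sum (D h) k.+1).
  rewrite mulKmx ?transfer_unit // => ->.
  by rewrite mulmxBr mulmx1 subrK.
move=> /matrixP/(_ i j) ->; rewrite !mxE summxE /= !fcoef_sum.
rewrite [X in _ + X]big1 ?addr0.
  rewrite big_ord_recr /= big1 ?add0r.
    by rewrite coef_transfer_pow; apply: eq_bigr => p _; rewrite eqxx andbT.
  move=> m _; rewrite coef_transfer_pow big1 // => p _.
  by have /gtn_eqF -> : (m < k)%N := ltn_ord m; rewrite andbF.
move=> l _; rewrite mulrC; apply: fcoef_mul_order => n' j' j'k.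
rewrite -[mulmx _ _]/(@transfer_pow _ (D h) k.+1) coef_transfer_pow big1 // => p _.
by have /ltn_eqF -> : (j' < k.+1)%N := j'k; rewrite andbF.
Qed.

Lemma gsaw_gf_transfer h : gsaw_gf h = \sum_(t : vertex (D h) | Daccepting t)
  invmx (1%:M - transfer_mx (D h)) (enum_rank (Dstart h)) (enum_rank t).
Proof.
apply: fpsP => n; apply: fpsP => k; rewrite !fcoef_sum /= card_gsaws.
under eq_bigr => t _ do rewrite coef_invmx !enum_rankK.
rewrite (exchange_big_dep xpredT) //= size_filter -sum1_count natr_sum big_mkcond.
apply: eq_bigr => p _.
(* For a given word only the term [t = walk_end p] can contribute. *)
transitivity (\sum_(t : vertex (D h) | t == walk_end p)
    if accepted p then (n == walk_steps p)%:R else 0 : int).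
  rewrite big_pred1_eq; case: (accepted p) => //=.
  by rewrite eq_sym; case: (n == _).
rewrite big_mkcond [RHS]big_mkcond; apply: eq_bigr => t _.
rewrite (is_walk_end (Dstart h) t) -/(walk_end p) [t == _]eq_sym /accepted.
case: (eqVneq (walk_end p) t) => [<-|_]; last by rewrite !andbF.
by rewrite andbT andbC.
Qed.

End GeneratingFunction.

Theorem theorem3p1 (h : nat) (h_ge2 : (2 <= h)%N) :
  (forall n k : nat,
     exists f : seq (edge (D h)) -> seq (nat * nat),
       set_bij (accepted_walks h n k) (gsaws h n k) f) /\
  (forall n k : nat, finite_set (gsaws h n k)) /\
  (1%:M - transfer_mx (D h) \in unitmx)%R /\
  (gsaw_gf h =
     \sum_(t : vertex (D h) | Daccepting t)
       invmx (1%:M - transfer_mx (D h)) (enum_rank (Dstart h)) (enum_rank t))%R.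
Proof.
split; first exact: walks_bijection.
split; first exact: gsaws_finite.
split; [exact: transfer_unit | exact: gsaw_gf_transfer].
Qed.
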